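(* Let $H=(\alpha,\beta)$ be a semi-norming $k$-hypergraph pair over $V=V_1\times\cdots\times V_k$. Then $H\cong\overline{H}$, and one of the following holds: (Type I) there exists a real $s\ge 1$ such that $\alpha(\psi)=\beta(\psi)=s/2$ for every $\psi\in{\rm supp}(\alpha)\cup{\rm supp}(\beta)$; (Type II) for every $\psi\in{\rm supp}(\alpha)\cup{\rm supp}(\beta)$ we have $\{\alpha(\psi),\beta(\psi)\}=\{0,1\}$.
   Context: A $k$-hypergraph pair $H=(\alpha,\beta)$ consists of finite nonempty sets $V_1,\dots,V_k$ and functions $\alpha,\beta:V\to\mathbb{R}$, where $V=V_1\times\cdots\times V_k$; its size is $|H|=\sum_{\omega\in V}(|\alpha(\omega)|+|\beta(\omega)|)$. All measures are positive. For a measure space $\mathcal M=(\Omega,\mathcal F,\mu)$, the space $\Omega^{V_1}\times\cdots\times\Omega^{V_k}$ (points $x=(x_{i,v})_{i\in[k],v\in V_i}$) carries the product measure, and each $\omega=(\omega_1,\dots,\omega_k)\in V$ defines the projection $\omega(x)=(x_{1,\omega_1},\dots,x_{k,\omega_k})\in\Omega^k$. For measurable $f:\Omega^k\to\mathbb C$, $f^H(x)=\prod_{\omega\in V} f(\omega(x))^{\alpha(\omega)}\,\overline{f(\omega(x))^{\beta(\omega)}}$, with the convention $0^0=1$ (non-integer complex powers taken with a fixed branch). When $\alpha,\beta\ge 0$, set $\|f\|_H=(\int f^H)^{1/|H|}$, and let $L_H(\mathcal M)$ be the set of measurable $f$ with $\|\,|f|\,\|_H<\infty$. $H$ (with $\alpha,\beta\ge0$)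 is called norming (resp. semi-norming) if $\|\cdot\|_H$ is a norm (resp. semi-norm) on $L_H(\mathcal M)$ for every measure space $\mathcal M$. An isomorphism from $H=(\alpha,\beta)$ over $V_1\times\cdots\times V_k$ to $H'=(\alpha',\beta')$ over $W_1\times\cdots\times W_k$ is a tuple of bijections $h_i:V_i\to W_i$ with $\alpha(\omega)=\alpha'(h(\omega))$, $\beta(\omega)=\beta'(h(\omega))$ for all $\omega$, where $h(\omega)=(h_1(\omega_1),\dots,h_k(\omega_k))$; write $H\cong H'$. $\overline{H}:=(\beta,\alpha)$. *)

(* Defs.v *)
From HB Require Import structures.
From mathcomp Require Import all_boot all_order all_algebra.
From mathcomp Require Import all_classical all_reals all_analysis.
From mathcomp Require Import complex.
Set Implicit Arguments.
Unset Strict Implicit.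
Unset Printing Implicit Defensive.
Import Order.TTheory GRing.Theory Num.Theory.
Local Open Scope ring_scope.
Local Open Scope classical_set_scope.

Section HypergraphPairs.
Variable R : realType.

(* Complex powers with real exponents, principal branch:               *)
(*   z^a = |z|^a (cos (a arg z) + i sin (a arg z)),  arg z in (-pi,pi]  *)
(* with arg 0 := 0 and the convention 0^0 = 1, 0^a = 0 for a <> 0      *)
(* (powR 0 0 = 1, powR 0 a = 0 for a <> 0).                            *)
Definition cmod (z : R[i]) : R :=
  Num.sqrt (complex.Re z ^+ 2 + complex.Im z ^+ 2).

Definition carg (z : R[i]) : R :=
  let r := cmod z in
  if r == 0 then 0
  else if 0 <= complex.Im z then acos (complex.Re z / r)
       else - acos (complex.Re z / r).

Definition cpow (z : R[i]) (a : R) : R[i] :=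
  Complex (powR (cmod z) a * cos (a * carg z))
          (powR (cmod z) a * sin (a * carg z)).

Variables (k : nat) (V : 'I_k -> finType).

Definition hvert := {dffun forall i : 'I_k, V i}.

(* the set of "coordinates" of Omega^{V_1} x ... x Omega^{V_k} *)
Definition hcoord := {i : 'I_k & V i}.

Definition hsize (alpha beta : hvert -> R) : R :=
  \sum_(w : hvert) (`|alpha w| + `|beta w|).

Definition hiso (alpha beta alpha' beta' : hvert -> R) : Prop :=
  exists h : forall i : 'I_k, V i -> V i,
    (forall i, bijective (h i)) /\
    forall w : hvert,
      let hw : hvert := [ffun i => h i (w i)] in
      alpha w = alpha' hw /\ beta w = beta' hw.

Definition supp2 (alpha beta : hvert -> R) (w : hvert) : Prop :=
  alpha w != 0 \/ beta w != 0.

(* A point x of Omega^{V_1} x ... x Omega^{V_k} is encoded as a tuple  *)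
(* s : #|hcoord|.-tuple T, with x_{i,v} = tnth s (enum_rank (i,v)).    *)
Section MeasureSpace.
Variables (d : measure_display) (T : measurableType d)
          (mu : {measure set T -> \bar R}).

(* Iterated integral w.r.t. mu in each coordinate (= integral against  *)
(* the product measure mu^n for nonnegative measurable integrands and  *)
(* sigma-finite mu, by Tonelli).                                       *)
Fixpoint iint (n : nat) : (n.-tuple T -> \bar R) -> \bar R :=
  match n return (n.-tuple T -> \bar R) -> \bar R with
  | 0 => fun F => F [tuple]
  | n'.+1 => fun F =>
      (\int[mu]_t iint (fun s : n'.-tuple T => F (cons_tuple t s)))%E
  end.

Definition cint (n : nat) (F : n.-tuple T -> R[i]) : R[i] :=
  let pos := fun (g : n.-tuple T -> R) => iint (fun s => (Num.max (g s) 0)%:E) in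
  let neg := fun (g : n.-tuple T -> R) => iint (fun s => (Num.max (- g s) 0)%:E) in
  let re := fun s => complex.Re (F s) in
  let im := fun s => complex.Im (F s) in
  Complex (fine (pos re) - fine (neg re)) (fine (pos im) - fine (neg im)).

Definition npts := #|{: hcoord}|.

Definition proj_omega (w : hvert) (s : npts.-tuple T) : k.-tuple T :=
  [tuple tnth s (enum_rank (Tagged V (w i))) | i < k].

Definition fH (alpha beta : hvert -> R) (f : k.-tuple T -> R[i])
    (s : npts.-tuple T) : R[i] :=
  \prod_(w : hvert)
     (cpow (f (proj_omega w s)) (alpha w) *
      conjc (cpow (f (proj_omega w s)) (beta w))).

(* L_H(M): measurable f : Omega^k -> C with || |f| ||_H < oo,          *)
(* i.e. int |f|^H < +oo.                                               *)
Definition in_LH (alpha beta : hvert -> R) (f : k.-tuple T -> R[i]) : Prop :=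
  [/\ measurable_fun setT (fun y => complex.Re (f y)),
      measurable_fun setT (fun y => complex.Im (f y)) &
      (iint (fun s => (complex.Re
          (fH alpha beta (fun y => Complex (cmod (f y)) 0) s))%:E) < +oo)%E].

(* ||f||_H = (int f^H)^(1/|H|), for int f^H a nonnegative real. *)
Definition hnorm (alpha beta : hvert -> R) (f : k.-tuple T -> R[i]) : R :=
  powR (complex.Re (cint (fH alpha beta f))) (hsize alpha beta)^-1.

Definition seminorm_on (alpha beta : hvert -> R) : Prop :=
  [/\ (forall f, in_LH alpha beta f ->
         complex.Im (cint (fH alpha beta f)) = 0 /\
         0 <= complex.Re (cint (fH alpha beta f))),
      (forall f g, in_LH alpha beta f -> in_LH alpha beta g ->
         in_LH alpha beta (fun y => f y + g y) /\
         hnorm alpha beta (fun y => f y + g y)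
           <= hnorm alpha beta f + hnorm alpha beta g) &
      (forall (c : R[i]) f, in_LH alpha beta f ->
         in_LH alpha beta (fun y => c * f y) /\
         hnorm alpha beta (fun y => c * f y) = cmod c * hnorm alpha beta f)].

End MeasureSpace.

Definition seminorming (alpha beta : hvert -> R) : Prop :=
  (forall w, 0 <= alpha w /\ 0 <= beta w) /\
  forall (d : measure_display) (T : measurableType d)
         (mu : {measure set T -> \bar R}),
    sigma_finite setT mu -> seminorm_on mu alpha beta.

End HypergraphPairs.

(* Main.v *)
Require Import Defs.
From HB Require Import structures.
From mathcomp Require Import all_boot all_order all_algebra.
From mathcomp Require Import all_classical all_reals all_analysis.
From mathcomp Require Import complex.
From mathcomp Require Import ring lra zify.
Import Order.TTheory GRing.Theory Num.Theory.
Local Open Scope ring_scope.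
Set Implicit Arguments.
Unset Strict Implicit.
Unset Printing Implicit Defensive.

(* Write [s = alpha + beta], [m = alpha - beta], let [F(f)] be the integral of
   [f^H] and [p = |H|]; only counting measures on finite sets [U] are needed.
   For [f = exp (u + i th)] with small [th], [F(f)] is a sum of exponentials
   [exp (<u, n(x)> + i <th, m(x)>)] over [x : hcoord -> U], where [n(x)] and
   [m(x)] are the push-forwards of [s] and [m] under [x]. Distinct exponentials
   are linearly independent, so identities for [F] can be read off exponent by
   exponent; for [U = hcoord], a map [x] with the exponent [n] of the identity
   permutes the support of [s].
   - [F] is real, so some [x] has the exponent of the identity with [m] negated:
     this is the isomorphism from [H] to its conjugate.
   - [F(-f) = F(f)], although the arguments of the values of [f] turn by [pi] or
     [-pi]; hence [m] is integer valued, and [f^H] is multiplicative in [f].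
   - Differentiating the triangle inequality on tensor powers of [f] and its
     conjugate gives a Hoelder inequality for each single edge; differentiating it
     again shows that the [f^H]-mean of [l] over the images of an edge does not
     depend on the edge. Hence [s] and [|m|] are constant on the support.
   - Take [f = 1] except for a value [z] at one point. Then
     [F = n0 + n1 |z|^s cos (m arg z) + O(|z|^(2s))]. Lipschitz continuity at
     [z = 0] forces [s >= 1]; if [m <> 0] and [s > 1], then moving from [0] to [z]
     and to [- z / 2] with [cos (m arg z) = -1] violates convexity. *)

(** * Integrals and seminorms for counting measures on finite sets *)

Section FiniteModel.
Local Open Scope classical_set_scope.
Variable R : realType.

(** Tuples of naturals form a countable type whose singletons are finite intersections of coordinate
    preimages, so every set of tuples is measurable. *)
Lemma tuple_discrete_measurable_fun (n : nat) (f : n.-tuple nat -> R) :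
  measurable_fun setT f.
Proof.
move=> _ Y _; apply: countable_measurable; last first.
  apply: (@sub_countable _ _ _ setT); first by apply: subset_card_le.
  exact: countableP.
move=> t.
have -> : [set t] = \bigcap_(i in [set: 'I_n]) ((fun s : n.-tuple nat => tnth s i) @^-1` [set tnth t i]).
  apply/seteqP; split => [s -> //|s /= st].
  by apply/eq_from_tnth => i; exact: st.
apply: fin_bigcap_measurable => [|i _]; first exact: finite_finset.
 rewrite -[X in measurable X]setTI.
exact: measurable_tnth.
Qed.

(** Counting measure on the naturals below [N]; a finite set [U] enters through its enumeration,
    with [N = #|U|]. *)
Definition pmeas (N : nat) : {measure set nat -> \bar R} :=
  msum (fun i => dirac i) N.

Lemma pmeas_sigma_finite N : sigma_finite setT (pmeas N).
Proof.
exists (fun=> setT); first by rewrite bigcup_const.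
move=> _; split => //=; rewrite /msum /=.
under eq_bigr do rewrite diracT.
by rewrite sumEFin ltry.
Qed.

Lemma integral_pmeas N (g : nat -> \bar R) : (forall t, (0 <= g t)%E) ->
  (\int[pmeas N]_t g t)%E = (\sum_(i < N) g i)%E.
Proof.
move=> g0; rewrite ge0_integral_measure_sum//.
by apply: eq_bigr => i _; rewrite integral_dirac// diracT mul1e.
Qed.

Lemma big_tuple_cons (N n : nat) (h : n.+1.-tuple 'I_N -> R) :
  \sum_s h s = \sum_i \sum_(s : n.-tuple 'I_N) h (cons_tuple i s).
Proof.
rewrite pair_bigA /= (reindex (fun p : 'I_N * n.-tuple 'I_N => cons_tuple p.1 p.2))//.
exists (fun s => (thead s, behead_tuple s)).
  by move=> [i s] _ /=; congr pair; apply: val_inj.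
by move=> s _ /=; rewrite [in RHS](tuple_eta s); apply: val_inj.
Qed.

Lemma iint_pmeas (n N : nat) (g : n.-tuple nat -> R) : (forall s, 0 <= g s) ->
  iint (pmeas N) (fun s => (g s)%:E) =
  (\sum_(s : n.-tuple 'I_N) g (map_tuple val s))%:E.
Proof.
elim: n g => [|n IH] g g0 /=.
  rewrite (big_pred1 [tuple]) => [|s]; first by congr (g _)%:E; exact: val_inj.
  by rewrite (tuple0 s) /= eqxx.
rewrite integral_pmeas => [|t]; last first.
  by rewrite IH // lee_fin; apply: sumr_ge0.
rewrite big_tuple_cons -sumEFin; apply: eq_bigr => i _.
rewrite IH //; congr (_%:E); apply: eq_bigr => s _; congr g; exact: val_inj.
Qed.

Lemma cint_pmeas (n N : nat) (F : n.-tuple nat -> R[i]) :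
  cint (pmeas N) F = \sum_(s : n.-tuple 'I_N) F (map_tuple val s).
Proof.
have key (g : n.-tuple nat -> R) :
  fine (iint (pmeas N) (fun s => (Num.max (g s) 0)%:E)) -
  fine (iint (pmeas N) (fun s => (Num.max (- g s) 0)%:E)) =
  \sum_(s : n.-tuple 'I_N) g (map_tuple val s).
  rewrite !iint_pmeas => [|s|s]; rewrite ?le_max ?lexx ?orbT//=.
  rewrite -sumrB; apply: eq_bigr => s _.
  by rewrite /Num.max; do 2 case: ltP => ?; lra.
rewrite /cint !key; apply/eqP; rewrite eq_complex /=.
by rewrite !raddf_sum !eqxx.
Qed.

Lemma cmod_real (r : R) : 0 <= r -> cmod (Complex r 0) = r.
Proof. by move=> r0; rewrite /cmod /= expr0n addr0 sqrtr_sqr ger0_norm. Qed.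

Lemma cpow_real (r a : R) : 0 <= r -> cpow (Complex r 0) a = Complex (r `^ a) 0.
Proof.
move=> r0; rewrite /cpow cmod_real//.
suff -> : carg (Complex r 0) = 0 by rewrite mulr0 cos0 sin0 mulr1 mulr0.
rewrite /carg cmod_real//=; case: eqP => // /eqP rn0.
by rewrite lexx divff// acos1.
Qed.

Section Model.
Variables (k : nat) (V : 'I_k -> finType) (alpha beta : hvert V -> R).
Hypothesis Hsn : seminorming alpha beta.

Definition cfac (w : hvert V) (z : R[i]) : R[i] :=
  cpow z (alpha w) * conjc (cpow z (beta w)).

Definition edge_pt (U : finType) (x : {ffun hcoord V -> U}) (w : hvert V)
  : {ffun 'I_k -> U} := [ffun i => x (Tagged V (w i))].

Definition hsum (U : finType) (f : {ffun 'I_k -> U} -> R[i]) : R[i] :=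
  \sum_(x : {ffun hcoord V -> U}) \prod_(w : hvert V) cfac w (f (edge_pt x w)).

Section Lift.
Variables (U : finType) (u0 : U).

(** Naturals beyond the enumeration of [U] are read as [u0]; [pmeas #|U|] gives them no mass. *)
Definition lift_fun (f : {ffun 'I_k -> U} -> R[i]) (y : k.-tuple nat) : R[i] :=
  f [ffun i => nth u0 (enum U) (tnth y i)].

Lemma cint_lift f :
  cint (pmeas #|U|) (fH alpha beta (lift_fun f)) = hsum f.
Proof.
rewrite cint_pmeas /hsum.
pose h (s : (npts V).-tuple 'I_#|U|) : {ffun hcoord V -> U} :=
  [ffun t => enum_val (tnth s (enum_rank t))].
rewrite (reindex h) /=.
  apply: eq_bigr => s _; apply: eq_bigr => w _.
  rewrite /cfac /lift_fun.
  suff -> : [ffun i => nth u0 (enum U) (tnth (proj_omega w (map_tuple val s)) i)]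
     = edge_pt (h s) w by [].
  apply/ffunP => i; rewrite !ffunE tnth_mktuple tnth_map.
  by rewrite (enum_val_nth u0).
exists (fun x : {ffun hcoord V -> U} => [tuple enum_rank (x (enum_val i)) | i < npts V]).
  by move=> s _; apply/eq_from_tnth => i; rewrite tnth_mktuple ffunE enum_valK enum_valK.
by move=> x _; apply/ffunP => t; rewrite ffunE tnth_mktuple enum_rankK enum_rankK.
Qed.

Lemma in_LH_lift f : in_LH (pmeas #|U|) alpha beta (lift_fun f).
Proof.
split; [exact: tuple_discrete_measurable_fun..|].
rewrite iint_pmeas ?ltry// => s.
suff : 0 <= fH alpha beta (fun y => Complex (cmod (lift_fun f y)) 0) s.
  by rewrite lecE => /andP[].
apply: prodr_ge0 => w _; rewrite !cpow_real ?sqrtr_ge0//.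
by rewrite /= oppr0 mulr_ge0// lecE /= eqxx powR_ge0.
Qed.

Lemma hsum_ge0 (f : {ffun 'I_k -> U} -> R[i]) : complex.Im (hsum f) = 0 /\ 0 <= complex.Re (hsum f).
Proof.
have [_ /(_ _ _ _ (pmeas_sigma_finite #|U|)) []] := Hsn.
by move=> /(_ _ (in_LH_lift f)); rewrite cint_lift.
Qed.

Definition hn (f : {ffun 'I_k -> U} -> R[i]) :=
  complex.Re (hsum f) `^ (hsize alpha beta)^-1.

Lemma hn_triangle (f g : {ffun 'I_k -> U} -> R[i]) : hn (fun y => f y + g y) <= hn f + hn g.
Proof.
have [_ /(_ _ _ _ (pmeas_sigma_finite #|U|)) []] := Hsn.
move=> _ /(_ _ _ (in_LH_lift f) (in_LH_lift g)) [_]; rewrite /hnorm !cint_lift.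
by rewrite -[X in fH _ _ X]/(lift_fun (fun y => f y + g y)) cint_lift.
Qed.

Lemma hn_scale (c : R[i]) (f : {ffun 'I_k -> U} -> R[i]) : hn (fun y => c * f y) = cmod c * hn f.
Proof.
have [_ /(_ _ _ _ (pmeas_sigma_finite #|U|)) []] := Hsn.
move=> _ _ /(_ c _ (in_LH_lift f)) [_]; rewrite /hnorm !cint_lift.
by rewrite -[X in fH _ _ X]/(lift_fun (fun y => c * f y)) cint_lift.
Qed.

End Lift.
End Model.
End FiniteModel.

(** * Polar form and the branch of complex powers *)

Section PolarNumbers.
Variable R : realType.
Implicit Types a b u : R.

Definition cexp a b : R[i] := Complex (expR a * cos b) (expR a * sin b).

Lemma cexpD a b a' b' : cexp (a + a') (b + b') = cexp a b * cexp a' b'.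
Proof.
rewrite /cexp expRD cosD sinD; apply/eqP; rewrite eq_complex /=.
by apply/andP; split; apply/eqP; ring.
Qed.

Lemma cexp0 : cexp 0 0 = 1.
Proof. by rewrite /cexp expR0 cos0 sin0 mulr1 mulr0. Qed.

Lemma conj_cexp a b : conjc (cexp a b) = cexp a (- b).
Proof. by rewrite /cexp cosN sinN mulrN. Qed.

Lemma cexp_sum (I : finType) (F G : I -> R) :
  cexp (\sum_i F i) (\sum_i G i) = \prod_i cexp (F i) (G i).
Proof.
apply: (big_ind3 (fun x y z => cexp x y = z)) => [|x1 y1 z1 x2 y2 z2 <- <-|//].
  exact: cexp0.
exact: cexpD.
Qed.

Lemma cexpX a b n : cexp a b ^+ n = cexp (n%:R * a) (n%:R * b).
Proof.
elim: n => [|n IH]; first by rewrite expr0 !mul0r cexp0.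
by rewrite exprS IH -cexpD -{1}[a]mul1r -{1}[b]mul1r -!mulrDl -nat1r.
Qed.

Lemma cexp_neq0 a b : cexp a b != 0.
Proof.
apply/eqP => E0; have : cexp a b * cexp (- a) (- b) = 0 by rewrite E0 mul0r.
by rewrite -cexpD !subrr cexp0 => /eqP; rewrite oner_eq0.
Qed.

Lemma cmod_cexp a b : cmod (cexp a b) = expR a.
Proof.
rewrite /cmod /= !exprMn -mulrDr cos2Dsin2 mulr1 sqrtr_sqr.
by rewrite ger0_norm ?expR_ge0.
Qed.

Lemma cexp_eq_mod a b a' b' : cexp a b = cexp a' b' -> a = a'.
Proof. by move=> /(congr1 (@cmod R)); rewrite !cmod_cexp; exact: expR_inj. Qed.

(** Angles of size at most 1 lie within [[- pi / 2, pi / 2]], where the sine is injective. *)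
Lemma cexp_inj_small a b a' b' : `|b| <= 1 -> `|b'| <= 1 ->
  cexp a b = cexp a' b' -> a = a' /\ b = b'.
Proof.
move=> b1 b1' E; have aa := cexp_eq_mod E; split => //.
move: E; rewrite aa => -[_ /mulfI]; rewrite expR_eq0 => /(_ isT).
have pi2 : 1 <= pi / 2 :> R by rewrite ler_pdivlMr// mul1r pi_ge2.
apply: sin_inj; rewrite in_itv /=.
  by move: b1; rewrite ler_norml => /andP[? ?]; apply/andP; split; lra.
by move: b1'; rewrite ler_norml => /andP[? ?]; apply/andP; split; lra.
Qed.

Lemma carg_cexp a b : - pi < b <= pi -> carg (cexp a b) = b.
Proof.
move=> /andP[b1 b2]; rewrite /carg cmod_cexp expR_eq0 /=.
rewrite [expR a * cos b / _]mulrAC divff ?expR_eq0// mul1r.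
rewrite pmulr_rge0 ?expR_gt0//.
case: (leP 0 b) => b0.
  by rewrite sin_ge0_pi ?b0// cosK// in_itv /= b0.
have sn : sin b < 0.
  by rewrite -[b]opprK sinN oppr_lt0 sin_gt0_pi// oppr_gt0 b0 ltrNl.
by rewrite leNgt sn /= -cosN cosK ?opprK// in_itv /= oppr_ge0 (ltW b0) lerNl ltW.
Qed.

Lemma cpow_cexp a b s : - pi < b <= pi -> cpow (cexp a b) s = cexp (s * a) (s * b).
Proof. by move=> bpi; rewrite /cpow carg_cexp// cmod_cexp /cexp (mulrC s a) expRM. Qed.

Lemma cexp_period a b (n : int) : cexp a (b + n%:~R * (pi *+ 2)) = cexp a b.
Proof.
have per (m : nat) c : cexp a (c + m%:R * (pi *+ 2)) = cexp a c.
  by rewrite mulr_natl /cexp (periodicn (@cosD2pi R)) (periodicn (@sinD2pi R)).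
case: n => m; first exact: per.
by rewrite NegzE mulrNz mulNr -[LHS](per m.+1) subrK.
Qed.

Lemma cexp_reduce_arg b : exists n : int, - pi < b + n%:~R * (pi *+ 2) <= pi.
Proof.
pose n := Num.ceil ((b - pi) / (pi *+ 2)).
have pi2 : 0 < pi *+ 2 :> R by rewrite pmulrn_lgt0// pi_gt0.
have /andP[n1 n2] := ceil_itv ((b - pi) / (pi *+ 2)).
exists (- n); move: n1 n2; rewrite -/n ltr_pdivlMr // ler_pdivrMr // => n1 n2.
by apply/andP; split; move: n1 n2; rewrite ?intrD rmorphN mulrBl mul1r; lra.
Qed.

(** Reducing [b] to the principal range shifts it by a multiple of [2 pi]; as [s - t] is an integer,
    the product only makes full turns. *)
Lemma cpow_cexp_conj a b s t (j : int) : s - t = j%:~R ->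
  cpow (cexp a b) s * conjc (cpow (cexp a b) t) = cexp ((s + t) * a) ((s - t) * b).
Proof.
move=> st; have [n bn] := cexp_reduce_arg b.
rewrite -(cexp_period a b n) !cpow_cexp// conj_cexp -cexpD.
rewrite -!mulrDl -mulNr -mulrDl st mulrDr mulrA -intrM cexp_period //.
Qed.

End PolarNumbers.

(** * Linear independence of exponentials *)

Section LinearIndependence.
Variable R : realType.

Lemma nonroot_exists (p : {poly R}) : p != 0 -> exists t, p.[t] != 0.
Proof.
move=> p0; apply: contrapT => H.
suff : (size [seq j%:R : R | j <- iota 0 (size p)] < size p)%N.
  by rewrite size_map size_iota ltnn.
apply: max_poly_roots => //.
  apply/allP => t /mapP[j _ ->]; apply/negPn/negP => jp; apply: H.
  by exists j%:R.
by rewrite map_inj_uniq ?iota_uniq//; apply: mulrIn; rewrite oner_eq0.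
Qed.

(** Along the curve [y |-> t ^+ enum_rank y] each nonzero row of [D] becomes a nonzero polynomial in
    [t]; a non-root of their product serves all rows. *)
Lemma generic_vector (I Y : finType) (D : I -> Y -> R) :
  exists a : Y -> R,
    forall i y, D i y != 0 -> \sum_y a y * D i y != 0.
Proof.
pose P i : {poly R} := \sum_y D i y *: 'X^(enum_rank y).
have coefPi i y : (P i)`_(enum_rank y) = D i y.
  rewrite coef_sum (bigD1 y)//= coefZ coefXn eqxx mulr1 big1 ?addr0// => z zy.
  rewrite coefZ coefXn; case: eqP => [/val_inj/enum_rank_inj yz|_].
    by rewrite yz eqxx in zy.
  by rewrite mulr0.
have [|t Qt] := @nonroot_exists (\prod_(i | [exists y, D i y != 0]) P i).
  apply/prodf_neq0 => i /existsP[y Dy]; apply: contraNneq Dy => Pi0.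
  by rewrite -coefPi Pi0 coef0.
exists (fun y => t ^+ enum_rank y) => i y Dy.
have : (P i).[t] != 0.
  move: Qt; rewrite horner_prod => /prodf_neq0; apply.
  by apply/existsP; exists y.
rewrite horner_sum; congr (_ != _); apply: eq_bigr => z _.
by rewrite hornerZ hornerXn mulrC.
Qed.

(* Linear independence of characters: evaluating along a geometric progression
   t -> exp (t d) in a generic direction d, the characters become powers of
   distinct nodes, separated by a polynomial vanishing at all nodes but one. *)
Lemma cexp_independent (X Y : finType) (n m : X -> Y -> R) (c : X -> R[i]) (e : R) :
  0 < e ->
  (forall u th : Y -> R, (forall y, `|th y| <= e) ->
     \sum_x c x * cexp (\sum_y u y * n x y) (\sum_y th y * m x y) = 0) ->
  forall x0, \sum_(x | [forall y, (n x y == n x0 y) && (m x y == m x0 y)]) c x = 0.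
Proof.
move=> e0 H x0.
pose D (q : X * bool) y := if q.2 then n q.1 y - n x0 y else m q.1 y - m x0 y.
have [a Ha] := generic_vector D.
pose J := #|X|.
pose A := 1 + \sum_y `|a y|.
pose B := 1 + \sum_x `|\sum_y a y * m x y|.
(* [d] is so small that the angles [j d a] stay within [e] for all [j <= J], and that each node has
   an angle of size at most 1, as [cexp_inj_small] requires. *)
have [d dE] : exists d, d = Num.min e 1 / (J.+1%:R * A * B) by eexists.
have A1 : 1 <= A by rewrite lerDl sumr_ge0.
have B1 : 1 <= B by rewrite lerDl sumr_ge0.
have J1 : 1 <= J.+1%:R :> R by rewrite ler1n.
have JAB : 0 < J.+1%:R * A * B by rewrite !mulr_gt0// (lt_le_trans ltr01).
have d0 : 0 < d by rewrite dE divr_gt0// lt_min e0 ltr01.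
have dJ (j : nat) y : (j <= J)%N -> `|j%:R * (d * a y)| <= e.
  move=> jJ; rewrite !normrM (ger0_norm (ltW d0)) normr_nat.
  have jJ' : j%:R <= J.+1%:R :> R by rewrite ler_nat leqW.
  have aA : `|a y| <= A.
    by rewrite /A (bigD1 y)//= addrCA lerDl addr_ge0// sumr_ge0.
  apply: (@le_trans _ _ (Num.min e 1)); last by rewrite ge_min lexx.
  have -> : Num.min e 1 = J.+1%:R * A * B * d by rewrite dE mulrC divfK// gt_eqF.
  rewrite mulrCA mulrA [leRHS]mulrC [d * _]mulrC -[leLHS]mulrA [leLHS]mulrA.
  rewrite [leLHS]mulrAC [leLHS]mulrC ler_wpM2l// ?(ltW d0)//.
  rewrite -[leLHS]mulr1 ler_pM ?mulr_ge0// ler_pM//.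
have dB x : `|d * \sum_y a y * m x y| <= 1.
  rewrite normrM (ger0_norm (ltW d0)) dE mulrAC ler_pdivrMr// mul1r.
  have mB : `|\sum_y a y * m x y| <= B.
    by rewrite /B (bigD1 x)//= addrCA lerDl addr_ge0// sumr_ge0.
  apply: ler_pM => //; first by rewrite le_min ltW//= ler01.
  rewrite ge_min; apply/orP; right.
  by rewrite -[leLHS]mulr1 ler_pM.
pose z x := cexp (d * \sum_y a y * n x y) (d * \sum_y a y * m x y).
(* By genericity of [a], two nodes coincide only if all their exponents do. *)
have zE x : (z x == z x0) = [forall y, (n x y == n x0 y) && (m x y == m x0 y)].
  apply/eqP/forallP => [/(cexp_inj_small (dB x) (dB x0))[]|E].
    move=> /(mulfI (lt0r_neq0 d0)) En /(mulfI (lt0r_neq0 d0)) Em y.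
    apply/andP; split; rewrite -subr_eq0; apply/negPn/negP => ny.
      have := Ha (x, true) y ny; rewrite /D /=.
      under eq_bigr do rewrite mulrBr.
      by rewrite sumrB En subrr eqxx.
    have := Ha (x, false) y ny; rewrite /D /=.
    under eq_bigr do rewrite mulrBr.
    by rewrite sumrB Em subrr eqxx.
  rewrite /z; congr (cexp (_ * _) (_ * _)); apply: eq_bigr => y _.
    by have /andP[/eqP -> _] := E y.
  by have /andP[_ /eqP ->] := E y.
have zj (j : nat) : (j <= J)%N -> \sum_x c x * z x ^+ j = 0.
  move=> jJ; rewrite -[RHS](H (fun y => j%:R * (d * a y)) (fun y => j%:R * (d * a y))).
    apply: eq_bigr => x _; rewrite cexpX; congr (_ * cexp _ _);
    by rewrite !mulr_sumr; apply: eq_bigr => y _; rewrite !mulrA.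
  by move=> y; exact: dJ.
pose P := \prod_(x | z x != z x0) ('X - (z x)%:P).
have sP : (size P <= J.+1)%N.
  rewrite /P -big_filter size_prod_XsubC ltnS size_filter.
  by rewrite (leq_trans (count_size _ _))// /J cardE enumT.
have P0 : P.[z x0] != 0.
  rewrite horner_prod; apply/prodf_neq0 => x xx0.
  by rewrite hornerXsubC subr_eq0 eq_sym.
have : \sum_x c x * P.[z x] = 0.
  under eq_bigr => x _ do rewrite (horner_coef_wide _ sP) mulr_sumr.
  rewrite exchange_big big1//= => j _.
  under eq_bigr => x _ do rewrite mulrCA.
  by rewrite -mulr_sumr zj ?mulr0// -ltnS.
rewrite (bigID (fun x => z x == z x0))/= [X in _ + X]big1 ?addr0; last first.
  move=> x xx0; rewrite horner_prod (bigD1 x)//= hornerXsubC subrr.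
  by rewrite mul0r mulr0.
under eq_bigr => x /eqP -> do [].
rewrite -mulr_suml => /eqP; rewrite mulf_eq0 (negbTE P0) orbF => /eqP E0.
by rewrite -[RHS]E0; apply: eq_bigl => x; rewrite zE.
Qed.

End LinearIndependence.

(** * Relations between exponential sums and their conjugates *)

Section ConjugateIndependence.
Variable R : realType.

(** Conjugation negates [m], so the hypothesis is a single linear relation indexed by [X * bool],
    where the boolean carries the sign and the factor [d]. *)
Lemma cexp_independent_conj (X Y : finType) (n m : X -> Y -> R) (c : X -> R[i])
    (d : R[i]) (e : R) : 0 < e ->
  (forall u th : Y -> R, (forall y, `|th y| <= e) ->
     \sum_x c x * cexp (\sum_y u y * n x y) (\sum_y th y * m x y) +
     d * \sum_x c x * conjc (cexp (\sum_y u y * n x y) (\sum_y th y * m x y)) = 0) ->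
  forall x0,
    \sum_(x | [forall y, (n x y == n x0 y) && (m x y == m x0 y)]) c x +
    d * \sum_(x | [forall y, (n x y == n x0 y) && (m x y == - m x0 y)]) c x = 0.
Proof.
move=> e0 H x0.
pose sg (q : X * bool) : R := if q.2 then -1 else 1.
have := @cexp_independent R (X * bool)%type Y (fun q => n q.1) (fun q y => sg q * m q.1 y)
  (fun q => (if q.2 then d else 1) * c q.1) e e0 _ (x0, false).
have split2 (P : pred (X * bool)) (G : X * bool -> R[i]) :
    \sum_(q | P q) G q = \sum_(x | P (x, false)) G (x, false)
                       + \sum_(x | P (x, true)) G (x, true).
  rewrite big_mkcond /=.
  transitivity (\sum_x \sum_b if P (x, b) then G (x, b) else 0).
    by rewrite pair_bigA; apply: eq_bigr => -[].
  transitivity (\sum_x ((if P (x, false) then G (x, false) else 0) +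
                        (if P (x, true) then G (x, true) else 0))).
    apply: eq_bigr => x _. by rewrite big_bool addrC.
  by rewrite big_split /= -!big_mkcond.
rewrite split2 /= /sg /= => E; rewrite -[RHS]E.
  rewrite mulr_sumr; congr (_ + _).
    apply: eq_big => [x|x _]; last by rewrite mul1r.
    by apply: eq_forallb => y; rewrite !mul1r.
  apply: eq_bigl => x; apply: eq_forallb => y.
  by rewrite mul1r mulN1r eqr_oppLR.
move=> u th th1; rewrite split2 /= -[RHS](H u th th1) mulr_sumr.
congr (_ + _); apply: eq_bigr => x _.
  by rewrite mul1r; congr (_ * cexp _ _); apply: eq_bigr => y _; rewrite mul1r.
rewrite conj_cexp mulrA; congr (_ * cexp _ _).
by rewrite -sumrN; apply: eq_bigr => y _; rewrite mulN1r mulrN.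
Qed.

End ConjugateIndependence.

(** * Push-forwards of edge weights and maps sharing the exponent of the identity *)

Section Pairs.
Variables (R : realType) (k : nat) (V : 'I_k -> finType) (alpha beta : hvert V -> R).
Hypothesis alpha_ge0 : forall w, 0 <= alpha w.
Hypothesis beta_ge0 : forall w, 0 <= beta w.

Let s (w : hvert V) := alpha w + beta w.
Let m (w : hvert V) := alpha w - beta w.

Definition push_weight (U : finType) (g : hvert V -> R) (x : {ffun hcoord V -> U})
  (y : {ffun 'I_k -> U}) : R := \sum_(w | edge_pt x w == y) g w.

Lemma push_weightE (U : finType) (g : hvert V -> R) (x : {ffun hcoord V -> U}) u :
  \sum_w g w * u (edge_pt x w) = \sum_y u y * push_weight g x y.
Proof.
rewrite (partition_big (edge_pt x) xpredT)//=; apply: eq_bigr => y _.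
by rewrite mulr_sumr; apply: eq_bigr => w /eqP ->; rewrite mulrC.
Qed.

Lemma total_weight_ge0 w : 0 <= s w. Proof. by rewrite addr_ge0. Qed.

Lemma total_weight_gt0 w : (0 < s w) = (s w != 0).
Proof. by rewrite lt0r total_weight_ge0 andbT. Qed.

Lemma total_weight0 w : s w = 0 -> alpha w = 0 /\ beta w = 0.
Proof. by move=> /eqP; rewrite paddr_eq0// => /andP[/eqP -> /eqP ->]. Qed.

Lemma hsizeE : hsize alpha beta = \sum_w s w.
Proof. by apply: eq_bigr => w _; rewrite !ger0_norm. Qed.

Definition polar_sum (U : finType) (u th : {ffun 'I_k -> U} -> R) : R[i] :=
  \sum_(x : {ffun hcoord V -> U})
    cexp (\sum_w s w * u (edge_pt x w)) (\sum_w m w * th (edge_pt x w)).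

Lemma hsum_polar_principal (U : finType) (u th : {ffun 'I_k -> U} -> R) :
  (forall y, - pi < th y <= pi) ->
  hsum alpha beta (fun y => cexp (u y) (th y)) = polar_sum u th.
Proof.
move=> thpi; apply: eq_bigr => x _; rewrite cexp_sum; apply: eq_bigr => w _.
by rewrite /cfac !cpow_cexp// conj_cexp -cexpD -!mulrDl -mulNr -mulrDl.
Qed.

Section SelfMaps.

(** A point whose coordinates are the coordinates themselves: distinct edges have distinct images,
    so its push-forwards display the weights edge by edge. *)
Definition id_pt : {ffun hcoord V -> hcoord V} := [ffun t => t].
Notation emb := (edge_pt id_pt).

Lemma emb_inj : injective emb.
Proof.
move=> w w' /ffunP E; apply/ffunP => i; have := E i; rewrite !ffunE.
by move/eqP; rewrite -tag_eqE /tag_eq /= eqxx tagged_asE => /eqP.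
Qed.

Lemma push_weight_emb g w : push_weight g id_pt (emb w) = g w.
Proof.
rewrite /push_weight (eq_bigl (pred1 w)) ?big_pred1_eq// => w'.
by rewrite /= (inj_eq emb_inj).
Qed.

Variable x : {ffun hcoord V -> hcoord V}.
Hypothesis sx : forall y, push_weight s x y = push_weight s id_pt y.

Lemma self_map_supp w : s w != 0 -> exists2 w', s w' != 0 & edge_pt x w = emb w'.
Proof.
move=> sw; have : push_weight s id_pt (edge_pt x w) != 0.
  rewrite -sx /push_weight (bigD1 w)//= gt_eqF// ltr_pwDl ?total_weight_gt0//.
  by rewrite sumr_ge0// => w' _; exact: total_weight_ge0.
move=> n0; have [w' /andP[/eqP E sw']|N] := pickP (fun w' => (emb w' == edge_pt x w) && (s w' != 0)).
  by exists w'.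
move: n0; rewrite /push_weight big1 ?eqxx// => w' /eqP Ew'.
by apply/eqP/negPn/negP => sw'; have := N w'; rewrite Ew' eqxx sw'.
Qed.

Lemma self_map_supp_surj w' : s w' != 0 -> exists2 w, s w != 0 & edge_pt x w = emb w'.
Proof.
move=> sw'; have n0 : push_weight s x (emb w') != 0 by rewrite sx push_weight_emb.
have [w /andP[/eqP E sw]|N] := pickP (fun w => (edge_pt x w == emb w') && (s w != 0)).
  by exists w.
move: n0; rewrite /push_weight big1 ?eqxx// => w /eqP Ew.
by apply/eqP/negPn/negP => sw; have := N w; rewrite Ew eqxx sw.
Qed.

(** By the two preceding lemmas [x] sends the support onto its embedded copy, which has the same
    cardinality. *)
Lemma self_map_supp_inj : {in [set w | s w != 0] &, injective (edge_pt x)}.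
Proof.
apply/imset_injP; rewrite (_ : edge_pt x @: _ = emb @: [set w | s w != 0]).
  by rewrite (card_imset _ emb_inj).
apply/setP => y; apply/imsetP/imsetP => -[w]; rewrite inE => sw ->.
  by have [w' sw' E] := self_map_supp sw; exists w' => //; rewrite inE.
by have [w' sw' E] := self_map_supp_surj sw; exists w' => //; rewrite inE.
Qed.

Lemma push_weight_self_map (g : hvert V -> R) w :
  (forall w, s w = 0 -> g w = 0) -> s w != 0 -> push_weight g x (edge_pt x w) = g w.
Proof.
move=> g0 sw; rewrite /push_weight (bigD1 w)//= big1 ?addr0// => w' /andP[/eqP E ww'].
apply: g0; apply/eqP/negPn/negP => sw'.
by rewrite (self_map_supp_inj _ _ E) ?inE// eqxx in ww'.
Qed.

End SelfMaps.
End Pairs.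

Lemma surjF_bij (T : finType) (h : T -> T) : (forall v, exists u, h u = v) -> bijective h.
Proof.
move=> hs; have [g gK] : exists g : T -> T, cancel g h.
  by have [g gP] := choice hs; exists g.
by apply: (@bij_can_bij _ _ g); [apply: injF_bij; exact: can_inj gK|exact: gK].
Qed.

(** * Isomorphism with the conjugate pair *)

Section Symmetry.
Variables (R : realType) (k : nat) (V : 'I_k -> finType) (alpha beta : hvert V -> R).
Hypothesis Hsn : seminorming alpha beta.

Let s (w : hvert V) := alpha w + beta w.
Let m (w : hvert V) := alpha w - beta w.

Let alpha_ge0 w : 0 <= alpha w. Proof. by have [/(_ w)[]] := Hsn. Qed.
Let beta_ge0 w : 0 <= beta w. Proof. by have [/(_ w)[]] := Hsn. Qed.

Lemma polar_sumE (U : finType) (u th : {ffun 'I_k -> U} -> R) :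
  polar_sum alpha beta u th =
  \sum_x 1 * cexp (\sum_y u y * push_weight s x y) (\sum_y th y * push_weight m x y).
Proof. by apply: eq_bigr => x _; rewrite mul1r -!push_weightE. Qed.

Lemma polar_sum_real (U : finType) (u0 : U) (u th : {ffun 'I_k -> U} -> R) :
  (forall y, - pi < th y <= pi) -> complex.Im (polar_sum alpha beta u th) = 0.
Proof.
move=> thpi; rewrite -hsum_polar_principal//.
by have [] := hsum_ge0 Hsn u0 (fun y => cexp (u y) (th y)).
Qed.

Lemma small_angle (th : R) : `|th| <= 1 -> - pi < th <= pi.
Proof.
have pi2 : 2 <= pi :> R := pi_ge2 R.
by rewrite ler_norml => /andP[? ?]; apply/andP; split; lra.
Qed.

(** The sum minus its conjugate vanishes. Independence then equates the number of maps with the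
    exponent of the identity, which is positive, with the number of those where [m] is negated. *)
Lemma reversing_self_map : hcoord V -> exists x : {ffun hcoord V -> hcoord V},
  (forall y, push_weight s x y = push_weight s (id_pt V) y) /\
  (forall y, push_weight m x y = - push_weight m (id_pt V) y).
Proof.
move=> t0.
have := @cexp_independent_conj R {ffun hcoord V -> hcoord V} {ffun 'I_k -> hcoord V}
  (push_weight s) (push_weight m) (fun=> 1) (-1) 1 ltr01 _ (id_pt V).
set A := (X in X + _); set B := (X in _ * X) => E.
have {}E : A + -1 * B = 0.
  apply: E => u th th1; rewrite -polar_sumE.
  rewrite [X in -1 * X](_ : _ = conjc (polar_sum alpha beta u th)); last first.
    rewrite polar_sumE rmorph_sum; apply: eq_bigr => x _.
    by rewrite rmorphM rmorph1.
  have := @polar_sum_real _ t0 u th (fun y => small_angle (th1 y)).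
  case: (polar_sum _ _ _ _) => a b /= ->; rewrite oppr0 mulN1r.
  exact: subrr.
have [x /forallP Hx|N] := pickP (fun x : {ffun hcoord V -> hcoord V} =>
    [forall y, (push_weight s x y == push_weight s (id_pt V) y) &&
               (push_weight m x y == - push_weight m (id_pt V) y)]).
  by exists x; split => y; have /andP[/eqP ? /eqP ?] := Hx y.
move: E; rewrite /B big_pred0// mulr0 addr0 /A (bigD1 (id_pt V))/=; last first.
  by apply/forallP => y; rewrite !eqxx.
move/eqP; rewrite gt_eqF// ltr_pwDl// sumr_ge0//.
Qed.

Lemma hiso_reversal : hcoord V -> hiso alpha beta beta alpha.
Proof.
move=> /reversing_self_map[x [sx mx]].
pose emb := edge_pt (id_pt V).
pose supp i v := [exists w, (s w != 0) && (w i == v)].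
(* A vertex on a supported edge is moved by [x] within its own part; fixing all other vertices keeps
   [h i] surjective. *)
pose h i v := if supp i v then
   odflt v [pick v' | x (Tagged V v) == Tagged V v' :> hcoord V] else v.
have h_edge w w' i : s w != 0 -> edge_pt x w = emb w' -> h i (w i) = w' i.
  move=> sw /ffunP/(_ i); rewrite !ffunE => E.
  have sp : supp i (w i) by apply/existsP; exists w; rewrite sw eqxx.
  rewrite /h sp; case: pickP => [v'|/(_ (w' i))]; rewrite E ?eqxx//.
  by rewrite -tag_eqE /tag_eq /= eqxx tagged_asE => /eqP ->.
have h_bij i : bijective (h i).
  apply: surjF_bij => v; have [/existsP[w' /andP[sw' /eqP <-]]|/negbTE sv] := boolP (supp i v).
    have [w sw E] := self_map_supp_surj sx sw'.
    by exists (w i); rewrite (h_edge w w').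
  by exists v; rewrite /h sv.
pose hh (w : hvert V) : hvert V := [ffun i => h i (w i)].
have hhE w w' : s w != 0 -> edge_pt x w = emb w' -> hh w = w'.
  by move=> sw E; apply/ffunP => i; rewrite ffunE (h_edge w w').
have hh_inj : injective hh.
  move=> w w' /ffunP E; apply/ffunP => i; have := E i; rewrite !ffunE.
  exact: (bij_inj (h_bij i)).
exists h; split => // w; rewrite -/(hh w) /=.
have [sw|sw] := eqVneq (s w) 0.
  (* A supported [hh w] would also be the image of a supported edge, against injectivity of [hh]. *)
  suff shw : s (hh w) = 0.
    have [-> ->] := total_weight0 alpha_ge0 beta_ge0 sw.
    by have [-> ->] := total_weight0 alpha_ge0 beta_ge0 shw.
  apply/eqP/negPn/negP => shw.
  have [w1 sw1 E] := self_map_supp_surj sx shw.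
  by have w1w := hh_inj _ _ (hhE _ _ sw1 E); move/eqP: sw1; apply; rewrite w1w.
have [w' sw' E] := self_map_supp alpha_ge0 beta_ge0 sx sw.
rewrite (hhE _ _ sw E).
have S : s w = s w'.
  rewrite -(push_weight_self_map alpha_ge0 beta_ge0 sx _ sw)// E sx.
  by rewrite push_weight_emb.
have M : m w = - m w'.
  rewrite -(push_weight_self_map alpha_ge0 beta_ge0 sx _ sw).
    by rewrite E mx push_weight_emb.
  by move=> w1 /(total_weight0 alpha_ge0 beta_ge0)[]; rewrite /m => -> ->; rewrite subrr.
by move: S M; rewrite /s /m; split; lra.
Qed.

End Symmetry.

(** * Integrality of the weight differences *)

Section Integrality.
Variables (R : realType) (k : nat) (V : 'I_k -> finType) (alpha beta : hvert V -> R).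
Hypothesis Hsn : seminorming alpha beta.

Let s (w : hvert V) := alpha w + beta w.
Let m (w : hvert V) := alpha w - beta w.

Let alpha_ge0 w : 0 <= alpha w. Proof. by have [/(_ w)[]] := Hsn. Qed.
Let beta_ge0 w : 0 <= beta w. Proof. by have [/(_ w)[]] := Hsn. Qed.

Lemma hsize_gt0 psi : s psi != 0 -> 0 < hsize alpha beta.
Proof.
move=> spsi; rewrite hsizeE// (bigD1 psi)//= ltr_pwDl ?total_weight_gt0//.
by rewrite sumr_ge0// => w _; exact: total_weight_ge0.
Qed.

(** Homogeneity gives equal norms, and the power [1 / |H|] is injective on nonnegative reals. *)
Lemma hsum_opp (U : finType) (u0 : U) (f : {ffun 'I_k -> U} -> R[i]) psi :
  s psi != 0 -> hsum alpha beta (fun y => -1 * f y) = hsum alpha beta f.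
Proof.
move=> spsi; have [If Rf] := hsum_ge0 Hsn u0 f.
have [Ig Rg] := hsum_ge0 Hsn u0 (fun y => -1 * f y).
apply/eqP; rewrite eq_complex If Ig eqxx andbT; apply/eqP.
have p0 : 0 < (hsize alpha beta)^-1 by rewrite invr_gt0 (hsize_gt0 spsi).
refine (powR_injective p0 _ _ _); [by rewrite nnegrE|by rewrite nnegrE|].
have := @hn_scale R k V alpha beta Hsn U u0 (-1) f; rewrite /hn => ->.
rewrite [cmod _](_ : _ = 1) ?mul1r//.
by rewrite /cmod /= oppr0 expr0n sqrrN expr1n addr0 sqrtr1.
Qed.

Lemma cexp0D (b b' : R) : cexp 0 (b + b') = cexp 0 b * cexp 0 b'.
Proof. by rewrite -cexpD addr0. Qed.

Lemma cexp_pi (a b : R) (d : bool) :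
  cexp a (b + pi * (-1) ^+ d) = -1 * cexp a b.
Proof.
have cpi : cexp 0 (pi * (-1) ^+ d) = -1 :> R[i].
  apply/eqP; rewrite eq_complex /= expR0 !mul1r.
  by case: d; rewrite ?mulr1 ?mulrN1 ?cosN ?sinN cospi sinpi ?oppr0 !eqxx.
by rewrite -[a in LHS]addr0 cexpD cpi mulrC.
Qed.

(* Multiplying f by -1 leaves the integral unchanged, but moves the arguments
   of the values in B by -pi and those of the other values by +pi. *)
Lemma half_turn psi (B : pred {ffun 'I_k -> hcoord V}) : hcoord V -> s psi != 0 ->
  cexp 0 (pi * \sum_y (-1) ^+ B y * push_weight m (id_pt V) y) = 1.
Proof.
move=> t0 spsi.
have pi2 : 2 <= pi :> R := pi_ge2 R.
(* The base argument is 1 on [B] and -1 elsewhere; with [|th| <= 1/2] the arguments before and after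
   the half turn are all principal. *)
pose b y : R := - (-1) ^+ B y.
pose c (x : {ffun hcoord V -> hcoord V}) : R[i] := cexp 0 (\sum_y b y * push_weight m x y) *
  (cexp 0 (pi * \sum_y (-1) ^+ B y * push_weight m x y) - 1).
have h2 : 0 < 1 / 2 :> R by rewrite divr_gt0.
have E : \sum_(x | [forall y, (push_weight s x y == push_weight s (id_pt V) y) &&
               (push_weight m x y == push_weight m (id_pt V) y)]) c x = 0.
  refine (@cexp_independent R _ _ (push_weight s) (push_weight m) c _ h2 _ (id_pt V)).
  move=> u th th1.
  have thb y : - pi < th y + b y <= pi /\
               - pi < (th y + b y) + pi * (-1) ^+ B y <= pi.
    have := th1 y; rewrite ler_norml /b => /andP[? ?].
    by case: (B y); rewrite ?expr0 ?expr1; split; apply/andP; split; lra.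
  have [th_1 th_2] := all_and2 thb.
  have := @hsum_opp _ t0 (fun y => cexp (u y) (th y + b y)) _ spsi.
  rewrite (hsum_polar_principal _ _ _ th_1).
  rewrite (_ : (fun y => -1 * _) =
    fun y => cexp (u y) (th y + b y + pi * (-1) ^+ B y)); last first.
    by apply/funext => y; rewrite cexp_pi.
  rewrite (hsum_polar_principal _ _ _ th_2) !polar_sumE => /eqP.
  rewrite -subr_eq0 -sumrB => /eqP F0; rewrite -[RHS]F0; apply: eq_bigr => x _.
  rewrite /c !mul1r -!mulrA mulrBl mul1r mulrBr -!cexpD !add0r.
  congr (cexp _ _ - cexp _ _).
    rewrite mulr_sumr -!big_split /=; apply: eq_bigr => y _; rewrite mulrA; ring.
  by rewrite -!big_split /=; apply: eq_bigr => y _; ring.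
(* All maps in this class have the coefficient of the identity, so that coefficient times a positive
   cardinality is 0. *)
rewrite (eq_bigr (fun=> c (id_pt V))) in E; last first.
  move=> x /forallP H; rewrite /c.
  by congr (cexp _ _ * (cexp _ (_ * _) - _)); apply: eq_bigr => y _;
     have /andP[_ /eqP ->] := H y.
move/eqP: E; rewrite sumr_const -mulr_natl mulf_eq0 pnatr_eq0.
rewrite -leqn0 leqNgt (cardD1 (id_pt V)) [X in (_ < X + _)%N](_ : _ = 1%N) /=; last first.
  by apply/eqP; rewrite eqb1; apply/forallP => y; rewrite !eqxx.
by rewrite /c mulf_eq0 (negbTE (cexp_neq0 _ _)) /= subr_eq0 => /eqP.
Qed.

Lemma cexp_eq1_int (t : R) : cexp 0 ((pi *+ 2) * t) = 1 -> exists j : int, t = j%:~R.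
Proof.
have [n bn] := cexp_reduce_arg ((pi *+ 2) * t).
rewrite -(cexp_period _ _ n) => /(congr1 (@carg R)); rewrite carg_cexp//.
rewrite -cexp0 carg_cexp; last by rewrite oppr_lt0 pi_gt0 pi_ge0.
rewrite mulrC -mulrDl => /eqP; rewrite mulf_eq0 mulrn_eq0/= (gt_eqF (pi_gt0 R)) orbF.
by rewrite addr_eq0 => /eqP ->; exists (- n); rewrite mulrNz.
Qed.

(** The half turns for the empty set and for the single image of [psi] differ by a rotation of angle
    [2 pi * m psi], which must be trivial. *)
Lemma weight_diff_int psi : hcoord V -> exists j : int, m psi = j%:~R.
Proof.
move=> t0; have [spsi|spsi] := eqVneq (s psi) 0.
  exists 0; rewrite /m; have [-> ->] := total_weight0 alpha_ge0 beta_ge0 spsi.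
  by rewrite subrr.
apply: cexp_eq1_int; rewrite -/(m psi).
have H0 := half_turn pred0 t0 spsi.
have := half_turn (pred1 (edge_pt (id_pt V) psi)) t0 spsi.
have -> : \sum_y (-1) ^+ (pred1 (edge_pt (id_pt V) psi) y) * push_weight m (id_pt V) y =
  \sum_y (-1) ^+ (pred0 y) * push_weight m (id_pt V) y - 2 * m psi.
  rewrite (bigD1 (edge_pt (id_pt V) psi))//= [in RHS](bigD1 (edge_pt (id_pt V) psi))//=.
  rewrite eqxx push_weight_emb expr1 expr0 mul1r [in RHS]addrAC.
  congr (_ + _); first ring.
  by apply: eq_bigr => y /negbTE ->.
rewrite mulrBr cexp0D H0 mul1r => H.
have : cexp 0 (- (pi * (2 * m psi)) + pi *+ 2 * m psi) = cexp 0 (pi *+ 2 * m psi) :> R[i].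
  by rewrite cexp0D H mul1r.
move=> E; rewrite -[LHS]E [X in cexp 0 X](_ : _ = 0) ?cexp0//; ring.
Qed.

Lemma hsum_polar (U : finType) (u th : {ffun 'I_k -> U} -> R) : hcoord V ->
  hsum alpha beta (fun y => cexp (u y) (th y)) = polar_sum alpha beta u th.
Proof.
move=> t0; apply: eq_bigr => x _; rewrite cexp_sum; apply: eq_bigr => w _.
by have [j mj] := weight_diff_int w t0; rewrite /cfac (cpow_cexp_conj _ _ mj).
Qed.

End Integrality.

(** * One-sided derivatives and growth of powers *)

Section OneSidedCalculus.
Variable R : realType.

Lemma is_derive_fsum (I : finType) (F : I -> R -> R) (dF : I -> R) (x : R) :
  (forall i, is_derive x 1 (F i) (dF i)) ->
  is_derive x 1 (fun t => \sum_i F i t) (\sum_i dF i).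
Proof.
move=> H; elim: (index_enum I) => [|i r IH].
  rewrite big_nil (_ : (fun t => _) = cst 0); first exact: is_derive_cst.
  by apply/funext => t; rewrite big_nil.
rewrite big_cons (_ : (fun t => _) = F i + (fun t => \sum_(j <- r) F j t)).
  exact: is_deriveD.
by apply/funext => t; rewrite big_cons.
Qed.

Lemma is_derive_ge0_right (f : R -> R) (d : R) : is_derive (0 : R) 1 f d ->
  f 0 = 0 -> (forall t, 0 < t -> 0 <= f t) -> 0 <= d.
Proof.
move=> [df fd] f0 fge0; rewrite -fd.
rewrite /derive (cvg_at_rightE _ _ df); apply: limr_ge.
  exact: (cvgP _ (cvg_dnbhs_at_right df)).
near=> h; have h0 : 0 < h by near: h; exact: nbhs_right_gt.
rewrite /= scaler1 addr0 f0 subr0; apply: mulr_ge0; last exact: fge0.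
by rewrite invr_ge0 ltW.
Unshelve. all: by end_near.
Qed.

(** If [d < b], Bernoulli's inequality makes [(b / d) ^+ n] grow at least linearly, past any
    constant. *)
Lemma expn_le_bound (b c d p : R) : 0 <= b -> 0 <= d -> 0 < c ->
  (forall n, c * b ^+ n <= p * d ^+ n) -> b <= d.
Proof.
move=> b0 d0 c0 H; rewrite leNgt; apply/negP => db.
have [d00|dn0] := eqVneq d 0.
  by have := H 1%N; rewrite d00 expr1 mulr0 leNgt mulr_gt0// -d00.
have {}d0 : 0 < d by rewrite lt0r dn0.
pose r := b / d - 1.
have r0 : 0 < r by rewrite subr_gt0 ltr_pdivlMr// mul1r.
have B n : 1 + n%:R * r <= (b / d) ^+ n.
  elim: n => [|n IH]; first by rewrite mul0r addr0 expr0.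
  rewrite exprS -nat1r; have -> : b / d = 1 + r by rewrite addrC subrK.
  rewrite -(addrC r 1) in IH *.
  apply: (@le_trans _ _ ((r + 1) * (1 + n%:R * r))).
    have : 0 <= n%:R * r * r by rewrite !mulr_ge0// ltW.
    nra.
  rewrite ler_wpM2l//; first by rewrite addr_ge0// ltW.
  by have -> : r + 1 = b / d by rewrite subrK.
have := Num.Theory.archi_boundP (divr_ge0 (normr_ge0 p) (ltW (mulr_gt0 c0 r0))).
set n := Num.bound _; rewrite ltr_pdivrMr ?mulr_gt0// => Hn.
have := H n; rewrite -ler_pdivrMr ?exprn_gt0// -mulrA -expr_div_n => Hp.
have := ler_wpM2l (ltW c0) (B n); have := ler_norm p.
nra.
Qed.

End OneSidedCalculus.

(** * Tensor powers of exponential sums *)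

Section Tensor.
Variables (R : realType) (k : nat) (V : 'I_k -> finType).

Definition ffun_comp (T U I : finType) (x : {ffun T -> {ffun I -> U}}) (j : I) : {ffun T -> U} :=
  [ffun t => x t j].

Lemma edge_pt_comp (U I : finType) (x : {ffun hcoord V -> {ffun I -> U}}) w j :
  ffun_comp (edge_pt x w) j = edge_pt (ffun_comp x j) w.
Proof. by apply/ffunP => i; rewrite !ffunE. Qed.

Lemma sum_prod_comp (T U I : finType) (P : I -> {ffun T -> U} -> R[i]) :
  \sum_(x : {ffun T -> {ffun I -> U}}) \prod_j P j (ffun_comp x j) = \prod_j \sum_x P j x.
Proof.
rewrite bigA_distr_bigA /=.
rewrite (reindex (fun x : {ffun T -> {ffun I -> U}} => [ffun j => ffun_comp x j])) /=.
  by apply: eq_bigr => x _; apply: eq_bigr => j _; rewrite ffunE.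
exists (fun g : {ffun I -> {ffun T -> U}} => [ffun t => [ffun j => g j t]]) => g _;
  by apply/ffunP => t; apply/ffunP => j; rewrite !ffunE.
Qed.

(** The sum factors over the components: [n] copies of [z], and [n] copies of its conjugate marked
    by [true]. *)
Lemma tensor_moment (T U : finType) (n : nat) (a b : {ffun T -> U} -> R) :
  let z := \sum_x cexp (a x) (b x) in
  \sum_(x : {ffun T -> {ffun 'I_n * bool -> U}})
     cexp (\sum_j a (ffun_comp x j)) (\sum_(j : 'I_n * bool) (-1) ^+ j.2 * b (ffun_comp x j)) =
  Complex ((complex.Re z ^+ 2 + complex.Im z ^+ 2) ^+ n) 0.
Proof.
move=> z; under eq_bigr => x _ do rewrite cexp_sum.
rewrite (sum_prod_comp (fun (j : 'I_n * bool) x => cexp (a x) ((-1) ^+ j.2 * b x))).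
rewrite -(pair_bigA _ (fun i (b' : bool) => \sum_x cexp (a x) ((-1) ^+ b' * b x))) /=.
rewrite (eq_bigr (fun=> conjc z * z)); last first.
  move=> i _; rewrite big_bool /=; congr (_ * _).
    rewrite /z rmorph_sum; apply: eq_bigr => x _.
    by rewrite -[RHS]/(conjc _) conj_cexp expr1 mulN1r.
  by apply: eq_bigr => x _; rewrite expr0 mul1r.
rewrite prodr_const card_ord.
have -> : conjc z * z = Complex (complex.Re z ^+ 2 + complex.Im z ^+ 2) 0.
  by case: z => p q; apply/eqP; rewrite eq_complex /=; apply/andP; split; apply/eqP; ring.
by rewrite -[RHS]/((_ ^+ n)%:C%C) rmorphXn.
Qed.

End Tensor.

(** * Derivatives at 0 of the functions to be compared *)

Section DerivativeAtZero.
Variable R : realType.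

Lemma is_derive_affine (a b : R) : is_derive (0 : R) 1 (fun t => a + t * b) b.
Proof.
have H : is_derive (0 : R) 1 ((cst a : R -> R) + (fun t => t * b)) (0 + b).
  apply: is_deriveD; rewrite (_ : (fun t => t * b) = b \*: (id : R -> R)).
    by apply: is_derive_eq; rewrite /GRing.scale /= mulr1.
  by apply/funext => t; rewrite /= /GRing.scale /= mulrC.
by rewrite add0r in H.
Qed.

Lemma is_derive_powR_affine (a b p : R) : 0 < a ->
  is_derive (0 : R) 1 (fun t => (a + t * b) `^ p) (p * a `^ (p - 1) * b).
Proof.
move=> a0.
have H1 := is_derive_affine a b.
have H2 : is_derive ((fun t => a + t * b) 0) 1 (fun x => x `^ p) (p * a `^ (p - 1)).
  by rewrite mul0r addr0; exact: is_derive1_powR.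
exact: (@is_derive1_comp _ (fun x => x `^ p) (fun t => a + t * b) _ _ _ H2 H1).
Qed.

Lemma is_derive_exp_sum_ln (I : finType) (g h : I -> R) (c : R) :
  is_derive (0 : R) 1 (fun t => c * expR (\sum_i g i * ln (1 + t * h i)))
    (c * \sum_i g i * h i).
Proof.
have H1 : is_derive (0 : R) 1 (fun t => \sum_i g i * ln (1 + t * h i)) (\sum_i g i * h i).
  apply: is_derive_fsum => i.
  have H2 := is_derive_affine 1 (h i).
  have H3 : is_derive ((fun t => 1 + t * h i) 0) 1 (@ln R) 1.
    have := @is_derive1_ln R 1 ltr01; rewrite invr1.
    by rewrite mul0r addr0.
  have H4 := @is_derive1_comp _ _ (fun t => 1 + t * h i) _ _ _ H3 H2.
  have := @is_deriveZ R R R _ (g i) 0 1 _ H4.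
  by rewrite /GRing.scale /= mul1r.
have H2 : is_derive ((fun t => \sum_i g i * ln (1 + t * h i)) 0) 1 (@expR R) 1.
  have := @is_derive_expR R 0; rewrite expR0; rewrite big1//.
  by move=> i _; rewrite mul0r addr0 ln1 mulr0.
have H3 := @is_derive1_comp _ _ (fun t => \sum_i g i * ln (1 + t * h i)) _ _ _ H2 H1.
have := @is_deriveZ R R R _ c 0 1 _ H3.
by rewrite /GRing.scale /= mul1r.
Qed.

Lemma is_derive_exp_affine (a b c : R) :
  is_derive (0 : R) 1 (fun t => c * expR (a + t * b)) (c * expR a * b).
Proof.
have H1 := is_derive_affine a b.
have H2 : is_derive ((fun t => a + t * b) 0) 1 (@expR R) (expR a).
  by rewrite mul0r addr0; exact: is_derive_expR.
have H3 := @is_derive1_comp _ _ (fun t => a + t * b) _ _ _ H2 H1.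
have := @is_deriveZ R R R _ c 0 1 _ H3.
by rewrite /GRing.scale /= mulrA.
Qed.

End DerivativeAtZero.

(** * Constancy of the weights on the support *)

Section Types.
Variables (R : realType) (k : nat) (V : 'I_k -> finType) (alpha beta : hvert V -> R).
Hypothesis Hsn : seminorming alpha beta.
Variables (t0 : hcoord V) (psi : hvert V).
Hypothesis spsi : alpha psi + beta psi != 0.

Let s (w : hvert V) := alpha w + beta w.
Let m (w : hvert V) := alpha w - beta w.
Let p := hsize alpha beta.

Let alpha_ge0 w : 0 <= alpha w. Proof. by have [/(_ w)[]] := Hsn. Qed.
Let beta_ge0 w : 0 <= beta w. Proof. by have [/(_ w)[]] := Hsn. Qed.
Let p_gt0 : 0 < p. Proof. exact: (hsize_gt0 Hsn spsi). Qed.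

Section Base.
Variables (U : finType) (u0 : U).
Implicit Types u th l : {ffun 'I_k -> U} -> R.

Definition polar_re u th : R := complex.Re (polar_sum alpha beta u th).

Lemma polar_sum_re u th : polar_sum alpha beta u th = Complex (polar_re u th) 0.
Proof.
have [H _] := hsum_ge0 Hsn u0 (fun y => cexp (u y) (th y)).
by apply/eqP; rewrite eq_complex /= eqxx -(hsum_polar Hsn)// H eqxx.
Qed.

Lemma polar_re_ge0 u th : 0 <= polar_re u th.
Proof.
have [_] := hsum_ge0 Hsn u0 (fun y => cexp (u y) (th y)).
by rewrite (hsum_polar Hsn).
Qed.

(* [marked_sum u th l w / polar_sum u th] is the mean of [exp l] over the images
   of the edge [w], for the complex weights [f^H] with [f = exp (u + i th)]. *)
Definition marked_sum u th l w : R[i] :=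
  \sum_x cexp (\sum_w s w * u (edge_pt x w) + l (edge_pt x w)) (\sum_w m w * th (edge_pt x w)).

Lemma polar_re_sum u th : polar_re u th =
  \sum_x expR (\sum_w s w * u (edge_pt x w)) * cos (\sum_w m w * th (edge_pt x w)).
Proof. by rewrite /polar_re raddf_sum. Qed.

(** The functions with log-moduli [u] and [u + l] have the same arguments [th], so adding [t] times
    the second to the first only changes the modulus. *)
Lemma triangle_polar u th l t : 0 < t ->
  polar_re (fun y => u y + ln (1 + t * expR (l y))) th <=
  (polar_re u th `^ p^-1 + t * polar_re (fun y => u y + l y) th `^ p^-1) `^ p.
Proof.
move=> t_gt0; have pn0 : p != 0 by rewrite gt_eqF.
have hnE u' : hn alpha beta (fun y => cexp (u' y) (th y)) = polar_re u' th `^ p^-1.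
  by rewrite /hn (hsum_polar Hsn).
have powK x : 0 <= x -> x = (x `^ p^-1) `^ p by move=> x0; rewrite -powRrM mulVf// powRr1.
rewrite [leLHS]powK ?polar_re_ge0//.
apply: ge0_ler_powR; rewrite ?nnegrE ?powR_ge0 ?addr_ge0 ?powR_ge0 ?mulr_ge0 ?powR_ge0//; [exact: ltW..|].
rewrite -!hnE -[t in leRHS]cmod_real ?(ltW t_gt0)// -(hn_scale Hsn u0).
apply: le_trans (hn_triangle Hsn u0 _ _); rewrite le_eqVlt; apply/orP; left; apply/eqP.
congr hn; apply/funext => y; apply/eqP; rewrite eq_complex /= !expRD lnK; last first.
  by rewrite posrE addr_gt0// mulr_gt0// expR_gt0.
by apply/andP; split; apply/eqP; ring.
Qed.

(** Both sides of [triangle_polar] agree at [t = 0], so their right derivatives there are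
    ordered. *)
Lemma sum_marked_sum_le u th l : 0 < polar_re u th ->
  \sum_w s w * complex.Re (marked_sum u th l w) <=
  p * (polar_re u th `^ (1 - p^-1) * polar_re (fun y => u y + l y) th `^ p^-1).
Proof.
move=> F0; have pn0 : p != 0 by rewrite gt_eqF.
set F := polar_re u th; set G := polar_re _ th.
pose f t := (F `^ p^-1 + t * G `^ p^-1) `^ p -
   \sum_(x : {ffun hcoord V -> U}) expR (\sum_w s w * u (edge_pt x w)) * cos (\sum_w m w * th (edge_pt x w)) *
       expR (\sum_w s w * ln (1 + t * expR (l (edge_pt x w)))).
rewrite -subr_ge0.
have D : is_derive (0 : R) 1 f (p * (F `^ p^-1) `^ (p - 1) * G `^ p^-1 -
   \sum_(x : {ffun hcoord V -> U}) expR (\sum_w s w * u (edge_pt x w)) * cos (\sum_w m w * th (edge_pt x w)) *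
     \sum_w s w * expR (l (edge_pt x w))).
  apply: is_deriveB; first by apply: is_derive_powR_affine; rewrite powR_gt0.
  by apply: is_derive_fsum => x; exact: is_derive_exp_sum_ln.
have f0 : f 0 = 0.
  rewrite /f mul0r addr0 -powRrM mulVf// powRr1 ?ltW// /F polar_re_sum.
  apply/eqP; rewrite subr_eq0; apply/eqP; apply: eq_bigr => x _.
  by rewrite [X in _ * expR X]big1 ?expR0 ?mulr1// => w _; rewrite mul0r addr0 ln1 mulr0.
have fge0 t : 0 < t -> 0 <= f t.
  move=> t_gt0; rewrite subr_ge0; apply: le_trans (triangle_polar u th l t_gt0).
  rewrite polar_re_sum le_eqVlt; apply/orP; left; apply/eqP; apply: eq_bigr => x _.
  under [in RHS]eq_bigr do rewrite mulrDr.
  by rewrite big_split /= expRD mulrAC.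
have := is_derive_ge0_right D f0 fge0.
rewrite -powRrM mulrBr mulVf// mulr1 -mulrA.
suff -> : \sum_w s w * complex.Re (marked_sum u th l w) =
  \sum_(x : {ffun hcoord V -> U}) expR (\sum_w s w * u (edge_pt x w)) * cos (\sum_w m w * th (edge_pt x w)) *
     \sum_w s w * expR (l (edge_pt x w)) by [].
under eq_bigr do rewrite raddf_sum mulr_sumr.
rewrite exchange_big /=; apply: eq_bigr => x _.
rewrite mulr_sumr; apply: eq_bigr => w _; rewrite /= expRD; ring.
Qed.

End Base.

Lemma powRXn (x r : R) n : 0 <= x -> (x ^+ n) `^ r = (x `^ r) ^+ n.
Proof. by move=> x0; rewrite -powR_mulrn// -powRrM mulrC powRrM powR_mulrn// powR_ge0. Qed.

(* The Hoelder-type inequality obtained by applying [sum_marked_sum_le] to the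
   tensor powers of f and its conjugate, for which every marked sum becomes a
   power of its squared modulus. *)
Lemma marked_sum_le (U : finType) (u0 : U) (u th l : {ffun 'I_k -> U} -> R) w :
  s w != 0 -> 0 < polar_re u th ->
  complex.Re (marked_sum u th l w) <=
  polar_re u th `^ (1 - p^-1) * polar_re (fun y => u y + l y) th `^ p^-1.
Proof.
move=> sw F0; set D := leRHS; have D0 : 0 <= D by rewrite mulr_ge0 ?powR_ge0.
set A := marked_sum u th l w.
suff AD : complex.Re A ^+ 2 + complex.Im A ^+ 2 <= D ^+ 2.
  by rewrite leNgt; apply/negP => DA; nra.
have A0 : 0 <= complex.Re A ^+ 2 + complex.Im A ^+ 2 by rewrite addr_ge0 ?sqr_ge0.
(* Tensor-power trick: the constants [s w] and [p] do not depend on [n] and disappear in the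
   limit. *)
apply: (@expn_le_bound _ _ (s w) _ p) => //; rewrite ?sqr_ge0 ?total_weight_gt0// => n.
pose W := {ffun 'I_n * bool -> U}.
pose ten (g : {ffun 'I_k -> U} -> R) (y : {ffun 'I_k -> W}) := \sum_j g (ffun_comp y j).
pose ten_th (y : {ffun 'I_k -> W}) := \sum_(j : 'I_n * bool) (-1) ^+ j.2 * th (ffun_comp y j).
have tenE (g : {ffun 'I_k -> U} -> R) (x : {ffun hcoord V -> W}) :
    \sum_w s w * ten g (edge_pt x w) =
    \sum_j (fun x' : {ffun hcoord V -> U} => \sum_w s w * g (edge_pt x' w)) (ffun_comp x j).
  rewrite /ten; under eq_bigr do rewrite mulr_sumr.
  by rewrite exchange_big; apply: eq_bigr => j _; apply: eq_bigr => w' _; rewrite edge_pt_comp.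
have ten_thE (x : {ffun hcoord V -> W}) :
    \sum_w m w * ten_th (edge_pt x w) =
    \sum_(j : 'I_n * bool) (-1) ^+ j.2 *
      (fun x' : {ffun hcoord V -> U} => \sum_w m w * th (edge_pt x' w)) (ffun_comp x j).
  rewrite /ten_th; under eq_bigr do rewrite mulr_sumr.
  rewrite exchange_big; apply: eq_bigr => j _; rewrite mulr_sumr.
  by apply: eq_bigr => w' _; rewrite edge_pt_comp mulrCA.
have polar_ten g : polar_re (ten g) ten_th = (polar_re g th ^+ 2) ^+ n.
  have := tensor_moment n (fun x' : {ffun hcoord V -> U} => \sum_w s w * g (edge_pt x' w))
    (fun x' => \sum_w m w * th (edge_pt x' w)).
  rewrite /= -[X in complex.Im X]/(polar_sum alpha beta g th) [in complex.Im _]polar_sum_re//.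
  rewrite expr0n addr0 => /(congr1 (@complex.Re R)) /= <-; congr complex.Re.
  by apply: eq_bigr => x _; rewrite tenE ten_thE.
have marked_ten w' : marked_sum (ten u) ten_th (ten l) w' =
    Complex ((complex.Re (marked_sum u th l w') ^+ 2 +
              complex.Im (marked_sum u th l w') ^+ 2) ^+ n) 0.
  have <- := tensor_moment n
    (fun x' : {ffun hcoord V -> U} => \sum_w s w * u (edge_pt x' w) + l (edge_pt x' w'))
    (fun x' => \sum_w m w * th (edge_pt x' w)).
  apply: eq_bigr => x _.
  rewrite tenE ten_thE /ten -big_split /=; congr (cexp _ _).
  by apply: eq_bigr => j _; rewrite edge_pt_comp.
have := @sum_marked_sum_le W [ffun=> u0] (ten u) ten_th (ten l).
rewrite polar_ten exprn_gt0 ?exprn_gt0// => /(_ isT).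
rewrite (_ : (fun y => ten u y + ten l y) = ten (fun y => u y + l y)); last first.
  by apply/funext => y; rewrite /ten big_split.
rewrite polar_ten !powRXn ?sqr_ge0 ?polar_re_ge0// ?(ltW F0)//.
rewrite -!exprMn -/D; apply: le_trans.
(* The other edges contribute powers of squared moduli, so the term of [w] alone is bounded by the
   sum. *)
rewrite (bigD1 w)//= marked_ten /= lerDl sumr_ge0// => w' _.
by rewrite mulr_ge0 ?total_weight_ge0// marked_ten /= exprn_ge0 ?addr_ge0 ?sqr_ge0.
Qed.

(** The derivative at [t = 0] of the real part of [marked_sum] along [t * l], not normalised by
    [polar_re u th]. *)
Definition edge_mean (U : finType) (u th l : {ffun 'I_k -> U} -> R) w : R :=
  \sum_(x : {ffun hcoord V -> U}) expR (\sum_w s w * u (edge_pt x w)) *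
     cos (\sum_w m w * th (edge_pt x w)) * l (edge_pt x w).

(** Along [t * l], [marked_sum_le] is an equality at [t = 0]; comparing right derivatives bounds
    each edge mean by the weighted average of all. *)
Lemma edge_mean_le (U : finType) (u0 : U) (u th l : {ffun 'I_k -> U} -> R) w :
  s w != 0 -> 0 < polar_re u th ->
  edge_mean u th l w <= p^-1 * \sum_v s v * edge_mean u th l v.
Proof.
move=> sw F0; set F := polar_re u th.
pose c (x : {ffun hcoord V -> U}) := expR (\sum_w s w * u (edge_pt x w)) *
     cos (\sum_w m w * th (edge_pt x w)).
pose G t := \sum_x cos (\sum_w m w * th (edge_pt x w)) *
   expR (\sum_w s w * u (edge_pt x w) + t * \sum_w s w * l (edge_pt x w)).
have GE t : G t = polar_re (fun y => u y + t * l y) th.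
  rewrite polar_re_sum; apply: eq_bigr => x _; rewrite mulrC; congr (expR _ * _).
  rewrite mulr_sumr -big_split /=; apply: eq_bigr => v _; ring.
pose A t := \sum_x cos (\sum_w m w * th (edge_pt x w)) *
   expR (\sum_w s w * u (edge_pt x w) + t * l (edge_pt x w)).
have AE t : A t = complex.Re (marked_sum u th (fun y => t * l y) w).
  by rewrite /marked_sum raddf_sum; apply: eq_bigr => x _; rewrite /= mulrC.
have G0 : G 0 = F by rewrite GE; congr polar_re; apply/funext => y; rewrite mul0r addr0.
have A0 : A 0 = F.
  by rewrite /F polar_re_sum; apply: eq_bigr => x _; rewrite mul0r addr0 mulrC.
have dG : is_derive (0 : R) 1 G (\sum_v s v * edge_mean u th l v).
  rewrite (_ : \sum_v _ = \sum_x cos (\sum_w m w * th (edge_pt x w)) *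
      expR (\sum_w s w * u (edge_pt x w)) * \sum_w s w * l (edge_pt x w)).
    by apply: is_derive_fsum => x; exact: is_derive_exp_affine.
  under eq_bigr do rewrite mulr_sumr; rewrite exchange_big; apply: eq_bigr => x _.
  by rewrite mulr_sumr; apply: eq_bigr => v _; ring.
have dA : is_derive (0 : R) 1 A (edge_mean u th l w).
  rewrite (_ : edge_mean u th l w = \sum_x cos (\sum_w m w * th (edge_pt x w)) *
      expR (\sum_w s w * u (edge_pt x w)) * l (edge_pt x w)).
    by apply: is_derive_fsum => x; exact: is_derive_exp_affine.
  by apply: eq_bigr => x _; rewrite [cos _ * _]mulrC.
have dGp : is_derive (0 : R) 1 (fun t => F `^ (1 - p^-1) * G t `^ p^-1)
    (F `^ (1 - p^-1) * (p^-1 * F `^ (p^-1 - 1) * \sum_v s v * edge_mean u th l v)).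
  have H1 : is_derive (G 0) 1 (fun x => x `^ p^-1) (p^-1 * F `^ (p^-1 - 1)).
    by rewrite G0; exact: is_derive1_powR.
  have H2 := @is_derive1_comp _ (fun x => x `^ p^-1) G _ _ _ H1 dG.
  exact: (@is_deriveZ R R R _ (F `^ (1 - p^-1)) 0 1 _ H2).
have pp : F `^ (1 - p^-1) * F `^ (p^-1 - 1) = 1.
  by rewrite -powRD ?(gt_eqF F0) ?implybT// addrA subrK subrr powRr0.
rewrite (_ : _ * (_ * _) = p^-1 * \sum_v s v * edge_mean u th l v) in dGp; last first.
  by rewrite -[in LHS]mulrA mulrCA [F `^ _ * (_ * _)]mulrA pp mul1r.
have dK := @is_deriveB R R R _ _ _ _ _ _ dGp dA.
have := is_derive_ge0_right dK; rewrite subr_ge0; apply.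
  rewrite [LHS]/(_ - _) /= G0 A0 -powRD ?(gt_eqF F0) ?implybT// subrK powRr1 ?(ltW F0)//.
  exact: subrr.
move=> t _; rewrite [X in 0 <= X](_ : _ = F `^ (1 - p^-1) * G t `^ p^-1 - A t)//.
by rewrite subr_ge0 GE AE; exact: marked_sum_le.
Qed.

(** No supported edge exceeds the average taken with weights [s v / p], so all of them attain it. *)
Lemma edge_mean_eq (U : finType) (u0 : U) (u th l : {ffun 'I_k -> U} -> R) w w' :
  s w != 0 -> s w' != 0 -> 0 < polar_re u th ->
  edge_mean u th l w = edge_mean u th l w'.
Proof.
move=> sw sw' F0; set a := p^-1 * \sum_v s v * edge_mean u th l v.
suff H v : s v != 0 -> edge_mean u th l v = a by rewrite !H.
move=> sv; have E : \sum_v s v * (a - edge_mean u th l v) = 0.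
  under eq_bigr do rewrite mulrBr.
  by rewrite sumrB -mulr_suml -hsizeE// /a mulVKf ?subrr// gt_eqF.
move: (E) => /eqP; rewrite psumr_eq0 => [/allP/(_ v (mem_index_enum _))|v' _].
  by rewrite mulf_eq0 (negbTE sv) /= subr_eq0 => /eqP.
have [->|sv'] := eqVneq (s v') 0; first by rewrite mul0r.
by rewrite mulr_ge0 ?total_weight_ge0// subr_ge0 edge_mean_le.
Qed.

(** Equality of the edge means of the indicator of [y1] is an exponential identity with coefficients
    [c]. Were [tau] never sent to [y1] by a map with the exponent of the identity, up to the sign of
    [m], these coefficients would be nonnegative and that of the identity 1. A map sending it there
    carries the weights of [psi] to [tau]. *)
Lemma same_type tau : s tau != 0 -> s tau = s psi /\ (m tau = m psi \/ m tau = - m psi).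
Proof.
move=> stau.
pose y1 := edge_pt (id_pt V) psi.
pose c (x : {ffun hcoord V -> hcoord V}) : R :=
  (edge_pt x psi == y1)%:R - (edge_pt x tau == y1)%:R.
(* Arguments of size at most [1 / M] give total angles below 1, so every cosine, and hence
   [polar_re u th], is positive. *)
pose M := 1 + \sum_w `|m w|.
have M1 : 1 <= M by rewrite lerDl sumr_ge0.
have e0 : 0 < M^-1 by rewrite invr_gt0 (lt_le_trans ltr01).
have := @cexp_independent_conj R _ _ (push_weight s) (push_weight m) (fun x => (c x)%:C%C) 1 M^-1
  e0 _ (id_pt V).
set P1 := (X in \sum_(x | X x) _ + _); set P2 := (X in _ * \sum_(x | X x) _).
move=> E.
have {}E : \sum_(x | P1 x) (c x)%:C%C + 1 * \sum_(x | P2 x) (c x)%:C%C = 0.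
  apply: E => u th th1.
  have F0 : 0 < polar_re u th.
    rewrite polar_re_sum (bigD1 (id_pt V))//=.
    have cos0 x : 0 < cos (\sum_w m w * th (edge_pt x w)).
      have pi2 : 2 <= pi :> R := pi_ge2 R.
      suff : `|\sum_w m w * th (edge_pt x w)| < 1.
        rewrite ltr_norml => /andP[? ?]; apply: cos_gt0_pihalf; apply/andP; split; lra.
      apply: le_lt_trans (ler_norm_sum _ _ _) _.
      apply: (@le_lt_trans _ _ ((\sum_w `|m w|) * M^-1)).
        by rewrite mulr_suml ler_sum// => w _; rewrite normrM ler_wpM2l.
      by rewrite ltr_pdivrMr ?(lt_le_trans ltr01)// mul1r ltrDr.
    rewrite ltr_pwDl ?mulr_gt0 ?expR_gt0// sumr_ge0// => x _.
    by rewrite mulr_ge0 ?expR_ge0// ltW.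
  have := @edge_mean_eq _ t0 u th (fun y => (y == y1)%:R) _ _ spsi stau F0.
  rewrite /edge_mean => /eqP; rewrite -subr_eq0 -sumrB => /eqP H.
  rewrite mul1r -big_split /=.
  transitivity ((2 * (\sum_x expR (\sum_w s w * u (edge_pt x w)) *
     cos (\sum_w m w * th (edge_pt x w)) * c x))%:C%C).
    rewrite rmorphM rmorph_sum mulr_sumr; apply: eq_bigr => x _.
    rewrite -!push_weightE; apply/eqP; rewrite eq_complex /=.
    by apply/andP; split; apply/eqP; ring.
  rewrite [X in 2 * X](_ : _ = 0) ?mulr0// -[RHS]H.
  by apply: eq_bigr => x _; rewrite mulrBr.
have [x xtau Px] : exists2 x, edge_pt x tau == y1 & P1 x || P2 x.
  apply: contrapT => N.
  have c0 x : P1 x || P2 x -> 0 <= (c x)%:C%C.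
    move=> Px; rewrite lecR /c; case: (boolP (edge_pt x tau == y1)) => [xt|_].
      by exfalso; apply: N; exists x.
    by rewrite subr0.
  have Pid : P1 (id_pt V) by apply/forallP => y; rewrite !eqxx.
  move/eqP: E; rewrite mul1r (bigD1 (id_pt V))//= gt_eqF//.
  rewrite -addrA ltr_pwDl//; last first.
    by rewrite addr_ge0// sumr_ge0// => x Hx; apply: c0; rewrite ?(andP Hx).1 ?Hx ?orbT.
  rewrite ltcR /c -/y1 eqxx; case: eqP => [xt|_]; last by rewrite mulr0n subr0 ltr01.
  by exfalso; apply: N; exists (id_pt V); rewrite ?Pid//; apply/eqP.
have sx y : push_weight s x y = push_weight s (id_pt V) y.
  by case/orP: Px => /forallP/(_ y)/andP[/eqP].
have m0 w : s w = 0 -> m w = 0.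
  by move=> /(total_weight0 alpha_ge0 beta_ge0)[]; rewrite /m => -> ->; rewrite subrr.
have stE := push_weight_self_map alpha_ge0 beta_ge0 sx (fun _ E => E) stau.
have mtE := push_weight_self_map alpha_ge0 beta_ge0 sx m0 stau.
rewrite (eqP xtau) in stE mtE; split.
  by rewrite -[LHS]stE sx push_weight_emb.
case/orP: Px => /forallP/(_ y1)/andP[_ /eqP]; rewrite mtE push_weight_emb.
  by left.
by right.
Qed.

End Types.

(** From [1 + x <= expR x] and [expR q - 1 <= q * expR q]: the growth in [r] is linear, uniformly on
    [[0, 1]]. *)
Lemma powR_1D_le (R : realType) (p r D : R) : 0 <= p -> 0 <= r <= 1 -> 0 <= D ->
  (1 + r * D) `^ p <= 1 + r * (p * D * expR (p * D)).
Proof.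
move=> p0 /andP[r0 r1] D0; have q0 : 0 <= p * (r * D) by rewrite !mulr_ge0.
apply: (@le_trans _ _ (expR (p * (r * D)))).
  rewrite [p * _]mulrC expRM ge0_ler_powR ?nnegrE ?expR_ge0 ?expR_ge1Dx//.
  by rewrite addr_ge0 ?mulr_ge0.
have e1 : expR (p * (r * D)) - 1 <= p * (r * D) * expR (p * (r * D)).
  have := expR_ge1Dx (- (p * (r * D))).
  move=> /(ler_wpM2r (expR_ge0 (p * (r * D)))); rewrite -expRD addNr expR0; lra.
rewrite -lerBlDl; apply: le_trans e1 _.
rewrite [p * (r * D)]mulrCA -[leLHS]mulrA ler_wpM2l// ler_wpM2l ?mulr_ge0//.
by rewrite ler_expR -[leRHS]mul1r ler_wpM2r// mulr_ge0.
Qed.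

(** * Functions equal to 1 except at one point, and bounds on the common weight *)

Section OnePoint.
Variables (R : realType) (k : nat) (V : 'I_k -> finType) (alpha beta : hvert V -> R).
Hypothesis Hsn : seminorming alpha beta.
Hypothesis k_gt0 : (0 < k)%N.
Variables (t0 : hcoord V) (psi : hvert V).
Hypothesis spsi : alpha psi + beta psi != 0.

Let s (w : hvert V) := alpha w + beta w.
Let m (w : hvert V) := alpha w - beta w.
Let p := hsize alpha beta.
Let N := hn alpha beta.
Let y1 : {ffun 'I_k -> bool} := [ffun=> true].

Let alpha_ge0 w : 0 <= alpha w. Proof. by have [/(_ w)[]] := Hsn. Qed.
Let beta_ge0 w : 0 <= beta w. Proof. by have [/(_ w)[]] := Hsn. Qed.
Let p_gt0 : 0 < p. Proof. exact: (hsize_gt0 Hsn spsi). Qed.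
Let s_gt0 : 0 < s psi. Proof. by rewrite total_weight_gt0. Qed.

Lemma hn_powK (U : finType) (u0 : U) (f : {ffun 'I_k -> U} -> R[i]) :
  hn alpha beta f `^ p = complex.Re (hsum alpha beta f).
Proof.
have [_ f0] := hsum_ge0 Hsn u0 f.
by rewrite /hn -powRrM mulVf ?powRr1// gt_eqF.
Qed.

(** The norm is convex, and for [p >= 1] so is its [p]-th power. *)
Lemma hsum_convex (U : finType) (u0 : U) (t : R) (f g : {ffun 'I_k -> U} -> R[i]) :
  1 <= p -> 0 <= t <= 1 ->
  complex.Re (hsum alpha beta (fun y => t%:C%C * f y + (1 - t)%:C%C * g y)) <=
  t * complex.Re (hsum alpha beta f) + (1 - t) * complex.Re (hsum alpha beta g).
Proof.
move=> p1 /andP[t_ge0 t_le1]; rewrite -!(hn_powK u0).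
have h0 h : 0 <= @hn R k V alpha beta U h by exact: powR_ge0.
have t1 : 0 <= 1 - t by rewrite subr_ge0.
have tri : hn alpha beta (fun y => t%:C%C * f y + (1 - t)%:C%C * g y) <=
    t * hn alpha beta f + (1 - t) * hn alpha beta g.
  have S c h : 0 <= c -> c * @hn R k V alpha beta U h = hn alpha beta (fun y => c%:C%C * h y).
    by move=> c0; rewrite (hn_scale Hsn u0) (cmod_real c0).
  by rewrite (S _ _ t_ge0) (S _ _ t1); exact: hn_triangle.
have t01 : 0 <= t * hn alpha beta f + (1 - t) * hn alpha beta g.
  by rewrite addr_ge0// mulr_ge0.
apply: le_trans (ge0_ler_powR (ltW p_gt0) (h0 _) t01 tri) _.
by apply: (convex_powR p1 (Itv01 t_ge0 t_le1)); rewrite inE /= in_itv /= h0.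
Qed.

Definition point_fun (z : R[i]) (y : {ffun 'I_k -> bool}) : R[i] :=
  if y == y1 then z else 1.

Definition hits (x : {ffun hcoord V -> bool}) : nat :=
  #|[set w | (s w != 0) && (edge_pt x w == y1)]|.

Let n0 : R := \sum_x (hits x == 0)%:R.
Let n1 : R := \sum_x (hits x == 1)%:R.
Let n2 : R := #|{: {ffun hcoord V -> bool}}|%:R.

Lemma hits0_ge1 : 1 <= n0.
Proof.
rewrite /n0 (bigD1 [ffun=> false])//= (_ : (hits _ == 0) = true); last first.
  rewrite cards_eq0; apply/eqP/setP => w; rewrite !inE; apply/negP => /andP[_ /eqP].
  by move=> /ffunP/(_ (Ordinal k_gt0)); rewrite !ffunE.
by rewrite lerDl sumr_ge0.
Qed.

Lemma hits1_ge1 : 1 <= n1.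
Proof.
(* The indicator of the vertices of [psi] sends no other edge to [y1]. *)
rewrite /n1 (bigD1 [ffun t => tagged t == psi (tag t)])//= (_ : (hits _ == 1) = true).
  by rewrite lerDl sumr_ge0.
apply/cards1P; exists psi; apply/setP => w; rewrite !inE.
apply/andP/eqP => [[_ /eqP/ffunP E]|->].
  by apply/ffunP => i; have := E i; rewrite !ffunE => /eqP.
by split => //; apply/eqP/ffunP => i; rewrite !ffunE /= eqxx.
Qed.

(** As [0^0 = 1], an edge sent to [y1] contributes 1 or 0 according to whether both its weights
    vanish, so only maps without hits survive. *)
Lemma hsum_point0 : hsum alpha beta (point_fun 0) = n0%:C%C.
Proof.
rewrite rmorph_sum; apply: eq_bigr => x _.
have cpow1 a : cpow (1 : R[i]) a = 1.
  by rewrite -cexp0 cpow_cexp ?mulr0// oppr_lt0 pi_gt0 pi_ge0.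
have cpow0 a : cpow (0 : R[i]) a = (a == 0)%:R%:C%C.
  rewrite -[0 : R[i]]/(Complex 0 0) cpow_real//.
  by have [->|a0] := eqVneq a 0; rewrite ?powRr0 ?powR0.
have cf w : cfac alpha beta w (point_fun 0 (edge_pt x w)) =
    (~~ ((s w != 0) && (edge_pt x w == y1)))%:R%:C%C.
  rewrite /cfac /point_fun; case: eqP => _; last first.
    by rewrite !cpow1 andbF -[conjc 1]/(1^*)%C rmorph1 mulr1.
  rewrite andbT negbK !cpow0 /s paddr_eq0//.
  by do 2 case: (_ == 0) => /=; apply/eqP; rewrite eq_complex /=; 
     apply/andP; split; apply/eqP; ring.
under eq_bigr do rewrite cf.
rewrite -rmorph_prod; congr (_%:C%C).
rewrite cards_eq0; case: (set_0Vmem [set w | (s w != 0) && (edge_pt x w == y1)]) => [E|[w]].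
  rewrite E eqxx big1// => w _; have := finset.in_set0 w; rewrite -E inE => ->//.
rewrite inE => Hw; rewrite (bigD1 w)//= Hw mul0r; case: eqP => // E.
by have := finset.in_set0 w; rewrite -E inE Hw.
Qed.

Lemma hsum_point_polar a b : complex.Re (hsum alpha beta (point_fun (cexp a b))) =
  \sum_x expR (a * s psi * (hits x)%:R) * cos (b * \sum_(w | edge_pt x w == y1) m w).
Proof.
have -> : point_fun (cexp a b) =
    fun y => cexp (if y == y1 then a else 0) (if y == y1 then b else 0).
  by apply/funext => y; rewrite /point_fun; case: eqP; rewrite ?cexp0.
rewrite (hsum_polar Hsn)// -[LHS]/(polar_re alpha beta _ _) polar_re_sum.
apply: eq_bigr => x _; congr (expR _ * cos _); last first.
  by rewrite mulr_sumr [RHS]big_mkcond; apply: eq_bigr => w _; case: eqP; rewrite ?mulr0// mulrC.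
rewrite -mulrA mulr_natr -sumr_const mulr_sumr [RHS]big_mkcond; apply: eq_bigr => w _ /=.
rewrite inE; have [sw|sw] := eqVneq (s w) 0.
  by rewrite [_ + _]sw mul0r.
by case: eqP => _; rewrite ?mulr0//= (same_type Hsn t0 spsi sw).1 mulrC.
Qed.

Lemma hsum_point_ge a : n0 + expR (a * s psi) * n1 <=
  complex.Re (hsum alpha beta (point_fun (cexp a 0))).
Proof.
rewrite hsum_point_polar mulr_sumr -big_split /=; apply: ler_sum => x _.
rewrite mul0r cos0 mulr1; case: (hits x) => [|[|j]] /=.
- by rewrite !mulr0 expR0 addr0.
- by rewrite add0r !mulr1.
- by rewrite mulr0 addr0 expR_ge0.
Qed.

(** For a single hit the difference is [m psi] up to sign, which the cosine ignores; for [a <= 0],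
    two or more hits give at most the square of [expR (a * s psi)]. *)
Lemma hsum_point_le a b : a <= 0 ->
  complex.Re (hsum alpha beta (point_fun (cexp a b))) <=
  n0 + expR (a * s psi) * cos (b * m psi) * n1 + expR (a * s psi) ^+ 2 * n2.
Proof.
move=> a0; rewrite hsum_point_polar /n2 -sum1_card natr_sum /n0 /n1 !mulr_sumr -!big_split /=.
apply: ler_sum => x _; rewrite mulr1.
have asp : a * s psi <= 0 by rewrite mulr_le0_ge0// ltW.
have m0 w : s w = 0 -> m w = 0.
  by move=> /(total_weight0 alpha_ge0 beta_ge0)[]; rewrite /m => -> ->; rewrite subrr.
have mE : \sum_(w | edge_pt x w == y1) m w =
    \sum_(w in [set w | (s w != 0) && (edge_pt x w == y1)]) m w.
  rewrite (bigID (fun w => s w != 0))/= addrC big1 ?add0r.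
    by apply: eq_bigl => w; rewrite inE andbC.
  by move=> w /andP[_]; rewrite negbK => /eqP; exact: m0.
rewrite mE /hits; set E := [set w | _].
case cE : #|E| => [|[|j]].
- move/eqP: cE; rewrite cards_eq0 => /eqP ->; rewrite big_set0 !mulr0 expR0 cos0 /=.
  by rewrite mulr1 addr0 lerDl sqr_ge0.
- have /cards1P[w Ew] : #|E| == 1 by rewrite cE.
  have : w \in E by rewrite Ew inE.
  rewrite inE => /andP[sw _]; rewrite Ew big_set1 !mulr1 add0r.
  have -> : cos (b * m w) = cos (b * m psi).
    have [_ [/= E'|/= E']] := same_type Hsn t0 spsi sw; rewrite {1}/m E'//.
    by rewrite mulrN cosN.
  by rewrite lerDl sqr_ge0.
- rewrite /= mulr0 !add0r -expRM_natr; set c := cos _.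
  apply: (@le_trans _ _ (expR (a * s psi * j.+2%:R) * 1)).
    by rewrite ler_wpM2l ?expR_ge0// cos_le1.
  by rewrite mulr1 ler_expR ler_wnM2l// ler_nat.
Qed.

Let N_ge0 (f : {ffun 'I_k -> bool} -> R[i]) : 0 <= N f. Proof. exact: powR_ge0. Qed.

Lemma weight_ge1 : 1 <= s psi.
Proof.
pose d (y : {ffun 'I_k -> bool}) : R[i] := (y == y1)%:R.
have n00 : 0 <= n0 := le_trans ler01 hits0_ge1.
(* [D] compares the indicator of [y1] with [point_fun 0]: raising the value there from 0 to [r]
   multiplies the norm by at most [1 + r * D]. *)
have [D D0 DE] : exists2 D, 0 <= D & N (point_fun 0) * D = N d.
  have N0 : 0 < N (point_fun 0).
    by rewrite powR_gt0// hsum_point0 (lt_le_trans ltr01)// hits0_ge1.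
  exists (N d / N (point_fun 0)); first exact: (divr_ge0 (N_ge0 _) (N_ge0 _)).
  by rewrite mulrC divfK ?(gt_eqF N0).
have key a : a <= 0 -> expR (a * s psi) <= n0 * (p * D * expR (p * D)) * expR a.
  move=> a0; set r := expR a.
  have r1 : r <= 1 by rewrite -expR0 ler_expR.
  have rp : 0 < r by rewrite expR_gt0.
  have tri : N (point_fun (cexp a 0)) <= N (point_fun 0) * (1 + r * D).
    rewrite mulrDr mulr1 mulrCA DE.
    rewrite -[r in leRHS](cmod_real (ltW rp)) -(hn_scale Hsn true).
    apply: le_trans (hn_triangle Hsn true _ _); rewrite le_eqVlt; apply/orP; left.
    apply/eqP; congr hn; apply/funext => y; rewrite /point_fun /d.
    case: eqP => _; rewrite ?mulr0 ?addr0// add0r mulr1.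
    by rewrite /cexp cos0 sin0 mulr1 mulr0.
  have rD : 0 <= 1 + r * D by rewrite addr_ge0 ?mulr_ge0 ?(ltW rp).
  have {tri} : complex.Re (hsum alpha beta (point_fun (cexp a 0))) <= n0 * (1 + r * D) `^ p.
    rewrite -(hn_powK true) -[n0]/(complex.Re n0%:C%C) -hsum_point0 -(hn_powK true) -(powRM _ (N_ge0 _) rD).
    apply: ge0_ler_powR tri; [exact: ltW p_gt0|exact: N_ge0|exact: mulr_ge0 (N_ge0 _) rD].
  move=> /(le_trans (hsum_point_ge a)) H.
  have E := powR_1D_le (ltW p_gt0) (_ : 0 <= r <= 1) D0.
  have {E} := ler_wpM2l n00 (E _); rewrite (ltW rp) r1 => /(_ isT).
  move=> /(le_trans H); rewrite [leRHS]mulrDr mulr1 lerD2l => {}H.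
  apply: (@le_trans _ _ (expR (a * s psi) * n1)).
    by rewrite -[leLHS]mulr1 ler_wpM2l ?expR_ge0 ?hits1_ge1.
  by apply: le_trans H _; rewrite mulrCA mulrC.
rewrite leNgt; apply/negP => s1.
set C := n0 * _ in key.
have s1' : 0 < 1 - s psi by rewrite subr_gt0.
have C0 : 0 <= C.
  by rewrite !mulr_ge0 ?expR_ge0// ?(ltW p_gt0)// (le_trans ler01 hits0_ge1).
(* At this [a] the difference [a * s psi - a] equals [C], so [key] reads [expR C <= C], against
   [expR C >= 1 + C]. *)
have := key (- (C / (1 - s psi))) _.
rewrite oppr_le0 (divr_ge0 C0 (ltW s1')) => /(_ isT).
rewrite -ler_pdivrMr ?expR_gt0// -expRN -expRD opprK.
rewrite (_ : _ + _ = C); first by have := expR_ge1Dx C; lra.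
have -> : - (C / (1 - s psi)) * s psi + C / (1 - s psi) = (C / (1 - s psi)) * (1 - s psi) by ring.
by rewrite divfK// gt_eqF.
Qed.

Lemma weight_le1 : m psi != 0 -> s psi <= 1.
Proof.
move=> mpsi; rewrite leNgt; apply/negP => s1.
have p1 : 1 <= p.
  rewrite /p hsizeE// (bigD1 psi)//= (le_trans (ltW s1))// lerDl sumr_ge0// => w _.
  exact: total_weight_ge0.
(* [kappa] is 2 to the power [- s psi], the factor lost by [|z|^s] when [|z|] is halved; it is below
   1/2 because [s psi > 1]. *)
pose kappa := expR (- (s psi * ln 2)) : R.
have kappa0 : 0 < kappa by rewrite expR_gt0.
have kappa_half : kappa < 1 / 2.
  have -> : 1 / 2 = expR (- ln 2) :> R by rewrite expRN lnK ?posrE// div1r.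
  by rewrite ltr_expR ltrN2 ltr_pMl// ln_gt0// ltr1n.
(* [rho] will be [|z1|^s]; this choice gives [3 * rho * n2 < 1 - 2 * kappa], so the quadratic
   remainder cannot offset the linear term. *)
pose rho := (1 - 2 * kappa) / (3 * (n2 + 1)).
have n20 : 0 <= n2 by rewrite ler0n.
have k1 : 0 < 1 - 2 * kappa by lra.
have n2p : 0 < 3 * (n2 + 1) by rewrite mulr_gt0// ltr_wpDl.
have rho0 : 0 < rho := divr_gt0 k1 n2p.
have rho1 : rho <= 1.
  rewrite ler_pdivrMr// mul1r.
  by move: (n2) n20 => n n_ge0; lra.
pose a := ln rho / s psi.
have a0 : a <= 0.
  by rewrite pmulr_lle0 ?invr_gt0// ln_le0.
have aE : expR (a * s psi) = rho by rewrite divfK ?gt_eqF// lnK.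
(* This angle makes the cosine of a single hit -1 at [z1]; [z2] is [- z1 / 2], so 0 is the mean of
   [z1] and [z2] with weights 1/3 and 2/3. *)
pose th := pi / m psi.
pose z1 := cexp a th; pose z2 := cexp (a - ln 2) (th + pi * (-1) ^+ false).
have z12 : 3^-1%:C%C * z1 + (1 - 3^-1)%:C%C * z2 = 0.
  rewrite /z2 cexp_pi /z1 /cexp expRD expRN lnK ?posrE//; apply/eqP.
  by rewrite eq_complex /=; apply/andP; split; apply/eqP; field.
have ln2 : 0 <= ln 2 :> R by rewrite ln_ge0// ler1n.
have F1 := hsum_point_le th a0.
have F2 : complex.Re (hsum alpha beta (point_fun z2)) <= n0 + rho * kappa * n1 + (rho * kappa) ^+ 2 * n2.
  have a20 : a - ln 2 <= 0 by rewrite subr_le0 (le_trans a0).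
  have := hsum_point_le (th + pi * (-1) ^+ false) a20.
  have -> : expR ((a - ln 2) * s psi) = rho * kappa.
    by rewrite mulrBl expRD aE /kappa [ln 2 * _]mulrC.
  move/le_trans; apply; rewrite lerD2r lerD2l ler_wpM2r//.
    exact: le_trans ler01 hits1_ge1.
  by rewrite -[leRHS]mulr1 ler_wpM2l ?cos_le1// mulr_ge0// ltW.
rewrite aE [th * _]divfK// cospi in F1.
have t01 : 0 <= (3^-1 : R) <= 1 by apply/andP; split; lra.
have := @hsum_convex _ true _ (point_fun z1) (point_fun z2) p1 t01.
have -> : (fun y => 3^-1%:C%C * point_fun z1 y + (1 - 3^-1)%:C%C * point_fun z2 y) =
    point_fun 0.
  apply/funext => y; rewrite /point_fun; case: eqP => _; first by rewrite z12.
  by rewrite !mulr1 -rmorphD addrC subrK.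
rewrite hsum_point0 [complex.Re _%:C%C]/= => H.
have n11 := hits1_ge1.
have rhoE : rho * (n2 + 1) * 3 = 1 - 2 * kappa.
  by rewrite -mulrA [_ * 3]mulrC divfK// gt_eqF// mulr_gt0// ltr_wpDl.
move: H F1 F2; set X1 := complex.Re _; set X2 := complex.Re _ => H F1 F2.
(* Three times the convexity inequality at 0, with [F1] and [F2] inserted; the terms [n0] cancel. *)
have A : rho * (n1 * (1 - 2 * kappa)) <= rho * (rho * n2 * (1 + 2 * kappa ^+ 2)).
  by clearbody X1 X2; move: (n0) (n1) (n2) H F1 F2 => c0 c1 c2 H F1 F2; lra.
move: A; rewrite (ler_pM2l rho0) => A.
have k2 : 1 + 2 * kappa ^+ 2 <= 3 by nra.
have rn : 0 <= rho * n2 by rewrite mulr_ge0// ltW.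
have := ler_wpM2l rn k2.
have := ler_wpM2r (ltW k1) n11.
lra.
Qed.

End OnePoint.

(** * Separation of the two types by whether the common weight difference vanishes *)

Theorem theorem2p1 (R : realType) (k : nat) (V : 'I_k -> finType)
    (alpha beta : hvert V -> R) :
  (0 < k)%N ->
  (forall i : 'I_k, (0 < #|{: V i}|)%N) ->
  seminorming alpha beta ->
  hiso alpha beta beta alpha /\
  ((exists s : R, 1 <= s /\
      forall w : hvert V, supp2 alpha beta w ->
        alpha w = s / 2 /\ beta w = s / 2) \/
   (forall w : hvert V, supp2 alpha beta w ->
      (alpha w = 0 /\ beta w = 1) \/ (alpha w = 1 /\ beta w = 0))).
Proof.
move=> k0 V0 Hsn.
have /card_gt0P[v _] := V0 (Ordinal k0).
pose t0 : hcoord V := Tagged V v.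
split; first exact: hiso_reversal Hsn t0.
have a0 w : 0 <= alpha w by have [/(_ w)[]] := Hsn.
have b0 w : 0 <= beta w by have [/(_ w)[]] := Hsn.
have suppE w : supp2 alpha beta w -> alpha w + beta w != 0.
  by move=> sw; apply/eqP => /(total_weight0 a0 b0)[aw bw]; case: sw; rewrite ?aw ?bw eqxx.
(* With empty support the second alternative holds vacuously. *)
have [[psi spsi]|N] := pselect (exists psi, alpha psi + beta psi != 0); last first.
  by right=> w /suppE sw; exfalso; apply: N; exists w.
have s1 := weight_ge1 Hsn k0 t0 spsi.
have [m0|mn0] := eqVneq (alpha psi - beta psi) 0.
  left; exists (alpha psi + beta psi); split => // w /suppE sw.
  have [/= sE mE] := same_type Hsn t0 spsi sw.
  have {}mE : alpha w - beta w = 0 by case: mE => ->; rewrite m0 ?oppr0.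
  by split; lra.
have sle1 := weight_le1 Hsn t0 spsi mn0.
(* A nonzero integer [m psi] with [|m psi| <= s psi <= 1] is 1 or -1. *)
have m1 : alpha psi - beta psi = 1 \/ alpha psi - beta psi = -1.
  have [j /= mj] := weight_diff_int Hsn psi t0.
  have j1 : j%:~R <= 1%:~R :> R by rewrite -mj; have := b0 psi; lra.
  have j2 : (-1)%:~R <= j%:~R :> R by rewrite -mj; have := a0 psi; lra.
  move: j1 j2 mn0; rewrite !ler_int mj intr_eq0 => j1 j2 jn0.
  have [->|->] : j = 1 \/ j = -1 by lia.
    by left.
  by right.
right=> w /suppE sw; have [/= sE mE] := same_type Hsn t0 spsi sw.
have : alpha w - beta w = 1 \/ alpha w - beta w = -1.
  by case: m1 mE => -> [] ->; rewrite ?opprK; [left|right|right|left].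
by move: s1 sle1 => /= s1 sle1; case=> ?; [right|left]; split; lra.
Qed.
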